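(* Let $r,\ell\ge 1$ be integers and let $M$ be a simple rank-$r$ matroid that has no $U_{2,\ell+2}$-minor and no minor isomorphic to any of the matroids $M_1,\dots,M_8,Q$ described below. Then $|M|\le \ell(r-1)+1$. Moreover, if $r\ge 2$, equality holds if and only if $M$ can be obtained by taking parallel connections of copies of $U_{2,\ell+1}$, i.e. $M$ belongs to the smallest class of matroids containing every matroid isomorphic to $U_{2,\ell+1}$ and closed under forming $P_e(M',M'')$ for members $M',M''$ with $E(M')\cap E(M'')=\{e\}$. The simple rank-$3$ matroids $M_1,\dots,M_8$ are specified by their $3$-element circuits (all other $3$-element subsets independent): - $M_1$: ground set $\{x_1,x_2,x_3,y_1,y_2,y_3,z_1,z_2,z_3\}$; circuits $\{x_1,x_2,x_3\}$ and $\{x_i,y_i,z_i\}$, $i=1,2,3$. - $M_2$: as $M_1$ plus the circuit $\{y_1,y_2,y_3\}$. - $M_3$: as $M_2$ plus the circuit $\{z_1,z_2,z_3\}$. - $M_4\cong M(K_4)$: ground set $\{a,b,c,d,g,h\}$; circuits $\{a,b,c\},\{a,d,h\},\{b,g,h\},\{c,d,g\}$. - $M_5$: ground set $\{a,b,c,d,e,f,h\}$; circuits $\{a,b,c\},\{a,d,h\},\{b,e,h\},\{c,f,h\}$. - $M_6$: as $M_5$ plus the circuit $\{d,e,f\}$. - $M_7$: ground set $\{a,b,c,d,e,f,h\}$; circuits $\{a,b,c\},\{a,d,h\},\{b,e,h\},\{c,e,f\}$. - $M_8$: ground set $\{a,b,c,d,e,f,h\}$; circuits $\{a,b,c\},\{a,d,h\},\{b,e,h\}$.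 $Q$ is the rank-$4$ matroid on $\{u_1,u_2,u_3,v_1,w_1,v_2,w_2,v_3,w_3\}$ in which, with $K=\{u_1,u_2,u_3\}$, $K_i=\{u_i,v_i,w_i\}$, $R_i=K\cup K_i$, the $3$-element circuits are exactly $K,K_1,K_2,K_3$ and the $4$-element circuits are exactly the $4$-element subsets of some $R_i$ containing neither $K$ nor $K_i$ (all other circuits have $5$ elements).
   Context: A matroid is simple if it has no loops and no parallel pairs. $|M|$ is the size of the ground set. $U_{2,n}$ is the rank-$2$ uniform matroid on $n$ elements. A minor is a matroid obtained by a sequence of deletions and contractions (up to isomorphism). Given matroids $M',M''$ with $E(M')\cap E(M'')=\{e\}$, the parallel connection $P_e(M',M'')$ is the matroid on $E(M')\cup E(M'')$ whose flats are exactly the sets $F$ with $F\cap E(M')$ a flat of $M'$ and $F\cap E(M'')$ a flat of $M''$. *)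

(* Defs.v *)
From mathcomp Require Import all_boot.

Set Implicit Arguments.
Unset Strict Implicit.
Unset Printing Implicit Defensive.

Record matroid (T : finType) := Matroid {
  ground : {set T};
  indep : pred {set T};
  indep_ground : forall X, indep X -> X \subset ground;
  indep0 : indep set0;
  indep_down : forall X Y : {set T}, X \subset Y -> indep Y -> indep X;
  indep_aug : forall X Y : {set T}, indep X -> indep Y -> #|X| < #|Y| ->
    exists2 y, y \in Y :\: X & indep (y |: X)
}.

Section Notions.
Variables (T : finType) (M : matroid T).

Definition rank_of (X : {set T}) : nat :=
  \max_(I : {set T} | indep M I && (I \subset X)) #|I|.

Definition rank : nat := rank_of (ground M).

Definition loop (e : T) : bool := (e \in ground M) && ~~ indep M [set e].

Definition parallel_pair (e f : T) : bool :=
  [&& e \in ground M, f \in ground M, e != f, ~~ loop e, ~~ loop f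
    & ~~ indep M [set e; f]].

Definition simple : Prop :=
  (forall e, ~~ loop e) /\ (forall e f, ~~ parallel_pair e f).

Definition flat (F : {set T}) : Prop :=
  F \subset ground M /\
  forall e, e \in ground M :\: F -> rank_of F < rank_of (e |: F).

End Notions.

Definition isomorphic (T U : finType) (M : matroid T) (N : matroid U) : Prop :=
  exists f : T -> U,
    [/\ {in ground M &, injective f},
        f @: ground M = ground N
      & forall X : {set T}, X \subset ground M -> indep N (f @: X) = indep M X].

Section Minors.
Variables (T : finType) (M : matroid T) (e : T).

Definition del_indep (X : {set T}) : bool := (e \notin X) && indep M X.

Fact del_ground X : del_indep X -> X \subset ground M :\ e.
Proof. by case/andP=> eX /indep_ground; rewrite subsetD1 eX andbT. Qed.

Fact del_indep0 : del_indep set0.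
Proof. by rewrite /del_indep in_set0 indep0. Qed.

Fact del_down (X Y : {set T}) : X \subset Y -> del_indep Y -> del_indep X.
Proof.
move=> sXY /andP[eY iY]; rewrite /del_indep (indep_down sXY iY) andbT.
by apply: contra eY; apply: (subsetP sXY).
Qed.

Fact del_aug (X Y : {set T}) : del_indep X -> del_indep Y -> #|X| < #|Y| ->
  exists2 y, y \in Y :\: X & del_indep (y |: X).
Proof.
move=> /andP[eX iX] /andP[eY iY] /(indep_aug iX iY)[y yYX iyX].
exists y; rewrite // /del_indep iyX andbT !inE negb_or eX andbT.
by apply: contraNneq eY => ->; case/setDP: yYX.
Qed.

Definition delete : matroid T :=
  Matroid del_ground del_indep0 del_down del_aug.

(* Contracting a loop (or a point outside the ground set) is deleting it. *)
Definition con_indep (X : {set T}) : bool :=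
  if indep M [set e] then (e \notin X) && indep M (e |: X) else del_indep X.

Fact con_ground X : con_indep X -> X \subset ground M :\ e.
Proof.
rewrite /con_indep; case: ifP => _; last exact: del_ground.
case/andP=> eX /indep_ground; rewrite subUset => /andP[_ sX].
by rewrite subsetD1 eX sX.
Qed.

Fact con_indep0 : con_indep set0.
Proof.
rewrite /con_indep; case: ifP => ie; last exact: del_indep0.
by rewrite in_set0 setU0 ie.
Qed.

Fact con_down (X Y : {set T}) : X \subset Y -> con_indep Y -> con_indep X.
Proof.
rewrite /con_indep; case: ifP => _ sXY; last exact: del_down.
case/andP=> eY iY; rewrite (indep_down (setUS _ sXY) iY) andbT.
by apply: contra eY; apply: (subsetP sXY).
Qed.

Fact con_aug (X Y : {set T}) : con_indep X -> con_indep Y -> #|X| < #|Y| ->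
  exists2 y, y \in Y :\: X & con_indep (y |: X).
Proof.
rewrite /con_indep; case: ifP => _; last exact: del_aug.
move=> /andP[eX iX] /andP[eY iY] ltXY.
have [|y] := indep_aug iX iY; first by rewrite !cardsU1 eX eY.
rewrite !inE negb_or -andbA => /and3P[ye yX /orP[/eqP yE|yY]] iyX.
  by rewrite yE eqxx in ye.
exists y; first by rewrite inE yX yY.
by rewrite setUCA iyX andbT !inE negb_or eq_sym ye eX.
Qed.

Definition contract : matroid T :=
  Matroid con_ground con_indep0 con_down con_aug.

End Minors.

Inductive minor (T : finType) (M : matroid T) : matroid T -> Prop :=
| minor_refl : minor M M
| minor_delete N e : minor M N -> e \in ground N -> minor M (delete N e)
| minor_contract N e : minor M N -> e \in ground N -> minor M (contract N e).

Definition has_minor (T U : finType) (M : matroid T) (N : matroid U) : Prop :=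
  exists2 M', minor M M' & isomorphic M' N.

Section Uniform.
Variables r n : nat.

Definition uniform_indep (X : {set 'I_n}) : bool := #|X| <= r.

Fact uniform_ground X : uniform_indep X -> X \subset [set: 'I_n].
Proof. by rewrite subsetT. Qed.

Fact uniform_indep0 : uniform_indep set0.
Proof. by rewrite /uniform_indep cards0. Qed.

Fact uniform_down (X Y : {set 'I_n}) :
  X \subset Y -> uniform_indep Y -> uniform_indep X.
Proof. by move/subset_leq_card; apply: leq_trans. Qed.

Fact uniform_aug (X Y : {set 'I_n}) :
  uniform_indep X -> uniform_indep Y -> #|X| < #|Y| ->
  exists2 y, y \in Y :\: X & uniform_indep (y |: X).
Proof.
move=> _ leY ltXY; have /subsetPn[y yY yX] : ~~ (Y \subset X).
  by apply: contraL ltXY => /subset_leq_card; rewrite leqNgt.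
exists y; first by rewrite inE yX.
by rewrite /uniform_indep cardsU1 yX; apply: leq_trans leY.
Qed.

Definition uniform : matroid 'I_n :=
  Matroid uniform_ground uniform_indep0 uniform_down uniform_aug.

End Uniform.

(* [parallel_connection e M1 M2 P] says that P is P_e(M1, M2); it determines  *)
(* P, as a matroid is determined by its ground set and its flats.             *)
Definition parallel_connection (T : finType) (e : T) (M1 M2 P : matroid T) :
    Prop :=
  [/\ ground M1 :&: ground M2 = [set e],
      ground P = ground M1 :|: ground M2
    & forall F : {set T}, F \subset ground P ->
        flat P F <-> flat M1 (F :&: ground M1) /\ flat M2 (F :&: ground M2)].

(* Working inside one ambient type T loses nothing: the ground sets of the    *)
(* two parts of a parallel connection are subsets of its ground set.          *)
Inductive parallel_closure (T : finType) (n : nat) : matroid T -> Prop :=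
| pc_base M : isomorphic M (uniform 2 n) -> parallel_closure n M
| pc_step e M1 M2 P :
    parallel_closure n M1 -> parallel_closure n M2 ->
    parallel_connection e M1 M2 P -> parallel_closure n P.

(* The matroid on {0, ..., n-1} of rank r whose circuits with at most r       *)
(* elements are the members of C, so that a set is independent iff it has at  *)
(* most r elements and contains no member of C.  The exchange axiom is        *)
(* decided by computation on characteristic bit sequences.                    *)
Section ByCircuits.
Variables (n r : nat) (C : seq (seq nat)).

Definition circ_set (c : seq nat) : {set 'I_n} := [set i | val i \in c].

Definition circ_indep (X : {set 'I_n}) : bool :=
  (#|X| <= r) && all (fun c => ~~ (circ_set c \subset X)) C.

Definition bits_indep (s : bitseq) : bool :=
  (count id s <= r) && all (fun c => ~~ all (nth false s) c) C.

Fixpoint bits (m : nat) : seq bitseq :=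
  if m is m'.+1 then map (cons true) (bits m') ++ map (cons false) (bits m')
  else [:: [::]].

Definition circ_check : bool :=
  let I := [seq s <- bits n | bits_indep s] in
  [&& all (fun c => (c != [::]) && all (fun i => i < n) c) C
    & all (fun s => let k := (count id s).+1 in
        all (fun t => (count id t == k) ==>
          has (fun i => [&& nth false t i, ~~ nth false s i
                          & bits_indep (set_nth false s i true)]) (iota 0 n))
        I) I].

Hypothesis chk : circ_check.

Let tobits (X : {set 'I_n}) : bitseq := [seq i \in X | i <- enum 'I_n].

Let size_tobits X : size (tobits X) = n.
Proof. by rewrite size_map size_enum_ord. Qed.

Let nth_tobits X (i : 'I_n) : nth false (tobits X) i = (i \in X).
Proof. by rewrite (nth_map i) ?size_enum_ord // nth_ord_enum. Qed.

Let count_tobits X : count id (tobits X) = #|X|.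
Proof. by rewrite count_map cardE -size_filter enumT; congr size. Qed.

Let mem_bits s : s \in bits (size s).
Proof.
elim: s => //= b s IHs; rewrite mem_cat.
by case: b; rewrite map_f ?orbT.
Qed.

Let tobits_indep X : bits_indep (tobits X) = circ_indep X.
Proof.
rewrite /bits_indep /circ_indep count_tobits; congr (_ && _).
apply: eq_in_all => c cC; congr (~~ _).
have /andP[/allP/(_ c cC)/andP[_ /allP ltc] _] := chk.
apply/allP/subsetP => [cX i | cX i ic].
  by rewrite inE => /cX; rewrite nth_tobits.
by rewrite -[i]/(val (Ordinal (ltc i ic))) nth_tobits cX // inE.
Qed.

Let tobitsU1 X (i : 'I_n) :
  set_nth false (tobits X) i true = tobits (i |: X).
Proof.
apply: (@eq_from_nth _ false) => [|j].
  by rewrite size_set_nth !size_tobits; apply/maxn_idPr.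
rewrite size_set_nth size_tobits (maxn_idPr _) // => ltj.
rewrite nth_set_nth /= -[j]/(val (Ordinal ltj)) !nth_tobits !inE.
by rewrite -val_eqE /=; case: eqP.
Qed.

Fact circ_ground X : circ_indep X -> X \subset [set: 'I_n].
Proof. by rewrite subsetT. Qed.

Fact circ_indep0 : circ_indep set0.
Proof.
rewrite /circ_indep cards0; apply/allP => c cC.
have /andP[/allP/(_ c cC)] := chk.
case: c {cC} => //= i c /andP[lti _] _; rewrite subset0.
by apply/set0Pn; exists (Ordinal lti); rewrite !inE eqxx.
Qed.

Fact circ_down (X Y : {set 'I_n}) :
  X \subset Y -> circ_indep Y -> circ_indep X.
Proof.
move=> sXY /andP[leY /allP cY]; rewrite /circ_indep.
rewrite (leq_trans (subset_leq_card sXY) leY); apply/allP => c /cY.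
by apply: contra => /subset_trans; apply.
Qed.

Fact circ_aug (X Y : {set 'I_n}) :
  circ_indep X -> circ_indep Y -> #|X| < #|Y| ->
  exists2 y, y \in Y :\: X & circ_indep (y |: X).
Proof.
move=> iX iY ltXY.
have [Z sZY cZ] : exists2 Z : {set 'I_n}, Z \subset Y & #|Z| = #|X|.+1.
  exists [set x in take #|X|.+1 (enum Y)].
    by apply/subsetP => x; rewrite inE => /mem_take; rewrite mem_enum.
  rewrite cardsE (card_uniqP _) ?take_uniq ?enum_uniq //.
  by rewrite size_takel // -cardE.
have iZ := circ_down sZY iY.
have inI W : circ_indep W -> tobits W \in [seq s <- bits n | bits_indep s].
  by move=> iW; rewrite mem_filter tobits_indep iW -(size_tobits W) mem_bits.
have /andP[_ /allP/(_ _ (inI _ iX))/allP/(_ _ (inI _ iZ))] := chk.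
rewrite !count_tobits cZ eqxx => /hasP[i].
rewrite mem_iota /= add0n => lti.
rewrite -[i]/(val (Ordinal lti)) !nth_tobits tobitsU1 tobits_indep.
case/and3P=> iinZ inX ok; exists (Ordinal lti) => //.
by rewrite inE inX (subsetP sZY).
Qed.

Definition circ_matroid : matroid 'I_n :=
  Matroid circ_ground circ_indep0 circ_down circ_aug.

End ByCircuits.

(* x1 x2 x3 y1 y2 y3 z1 z2 z3 = 0 1 2 3 4 5 6 7 8 *)
Definition C1 : seq (seq nat) :=
  [:: [:: 0; 1; 2]; [:: 0; 3; 6]; [:: 1; 4; 7]; [:: 2; 5; 8]].
Definition C2 : seq (seq nat) := [:: 3; 4; 5] :: C1.
Definition C3 : seq (seq nat) := [:: 6; 7; 8] :: C2.

(* a b c d g h = 0 1 2 3 4 5 *)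
Definition C4 : seq (seq nat) :=
  [:: [:: 0; 1; 2]; [:: 0; 3; 5]; [:: 1; 4; 5]; [:: 2; 3; 4]].

(* a b c d e f h = 0 1 2 3 4 5 6, up to C8 *)
Definition C5 : seq (seq nat) :=
  [:: [:: 0; 1; 2]; [:: 0; 3; 6]; [:: 1; 4; 6]; [:: 2; 5; 6]].
Definition C6 : seq (seq nat) := [:: 3; 4; 5] :: C5.
Definition C7 : seq (seq nat) :=
  [:: [:: 0; 1; 2]; [:: 0; 3; 6]; [:: 1; 4; 6]; [:: 2; 4; 5]].
Definition C8 : seq (seq nat) :=
  [:: [:: 0; 1; 2]; [:: 0; 3; 6]; [:: 1; 4; 6]].

(* u1 u2 u3 v1 w1 v2 w2 v3 w3 = 0 1 2 3 4 5 6 7 8 *)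
Definition QK : seq nat := [:: 0; 1; 2].
Definition QKs : seq (seq nat) := [:: [:: 0; 3; 4]; [:: 1; 5; 6]; [:: 2; 7; 8]].

(* The 4-element subsets of R = K \cup Ki, which has 5 elements, are obtained *)
(* by removing one element.                                                   *)
Definition Q4 (Ki : seq nat) : seq (seq nat) :=
  let R := undup (QK ++ Ki) in
  [seq c <- [seq rem x R | x <- R] |
    ~~ all (mem c) QK && ~~ all (mem c) Ki].

Definition CQ : seq (seq nat) := QK :: QKs ++ flatten (map Q4 QKs).

Fact check1 : circ_check 9 3 C1. Proof. by vm_compute. Qed.
Fact check2 : circ_check 9 3 C2. Proof. by vm_compute. Qed.
Fact check3 : circ_check 9 3 C3. Proof. by vm_compute. Qed.
Fact check4 : circ_check 6 3 C4. Proof. by vm_compute. Qed.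
Fact check5 : circ_check 7 3 C5. Proof. by vm_compute. Qed.
Fact check6 : circ_check 7 3 C6. Proof. by vm_compute. Qed.
Fact check7 : circ_check 7 3 C7. Proof. by vm_compute. Qed.
Fact check8 : circ_check 7 3 C8. Proof. by vm_compute. Qed.
Fact checkQ : circ_check 9 4 CQ. Proof. by vm_compute. Qed.

Definition M_1 : matroid 'I_9 := circ_matroid check1.
Definition M_2 : matroid 'I_9 := circ_matroid check2.
Definition M_3 : matroid 'I_9 := circ_matroid check3.
Definition M_4 : matroid 'I_6 := circ_matroid check4.
Definition M_5 : matroid 'I_7 := circ_matroid check5.
Definition M_6 : matroid 'I_7 := circ_matroid check6.
Definition M_7 : matroid 'I_7 := circ_matroid check7.
Definition M_8 : matroid 'I_7 := circ_matroid check8.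
Definition Q : matroid 'I_9 := circ_matroid checkQ.

(* Main.v *)
Require Import Defs.
From mathcomp Require Import all_boot zify.

(* A long line is a rank-2 flat with at least three points.  Some point e of M
   lies on at most one long line: otherwise choose a long line L and a nonempty
   union X of components of M / L with |X| minimal.  For every other long line K
   inside L + X, minimality makes (M | (L + X)) / K connected, and every point
   of K lies on a second long line inside L + X.  Take three points of K and
   such a line through each.  Contracting elements of (M | (L + X)) / K makes
   the three images in M / K either parallel or a 3-element circuit; the first
   case is a rank-3 configuration with a minor among M_1, ..., M_8, the second
   a rank-4 configuration with minor Q or, after one contraction, one of
   M_4, ..., M_8.
   Contracting e and simplifying loses at most l points, which gives the bound.
   In the extremal case the contraction is a parallel connection of lines by
   induction; a leaf line of it lifts to a set S of l points spanning, with the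
   rest of M, only one more dimension.  Each line joining two points of S must
   meet the rest of M (contract one of the points and count), so S is collinear
   as M has no M(K_4)-minor, and M is a parallel connection along S. *)

Set Implicit Arguments.
Unset Strict Implicit.
Unset Printing Implicit Defensive.

(** Losing at most l points in the induction needs at most one nontrivial parallel class in M / e;
    this is what the good point e provides. The forbidden matroids other than the uniform one enter
    there, and M_4 enters once more in the extremal case.

    Minimality ranges over all pairs (L, X), not over X for a fixed L. If (M | (L + X)) / K splits,
    a part that misses L is separated from all the rest in M / K, so it forms a smaller pair with K:
    it lacks the points of K in X. If both parts meet L, a third point of L lies with one of them
    and drags a point of the other into K, which is absurd.

    The ranks 3 and 4 arise as 2 + 1 and 2 + 2: K has rank 2, and three points that are connected
    over the contracted set have rank 1 or 2 over it. K must not collapse meanwhile, so only points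
    outside K are contracted, one by one and each independent of the previous ones.

    In the extremal case the leaf line has to avoid the point f that represents L in the
    contraction; otherwise it would not lift. Hence leaf lines are shown to exist off any prescribed
    point. *)

Section RankTheory.
Variables (T : finType) (M : matroid T).
Implicit Types (A B C D I J X Y Z : {set T}) (x y : T).
Local Notation r := (rank_of M).

Lemma indep_le_rank I X : indep M I -> I \subset X -> #|I| <= r X.
Proof. by move=> iI sIX; apply: (leq_bigmax_cond I); rewrite iI sIX. Qed.

Lemma rank_basis X : exists I, [/\ indep M I, I \subset X & #|I| = r X].
Proof.
have [|I /andP[iI sIX] eI] :=
  @eq_bigmax_cond _ [pred I : {set T} | indep M I && (I \subset X)] (fun I => #|I|).
  by apply/card_gt0P; exists set0; rewrite inE indep0 sub0set.
by exists I; rewrite iI sIX /rank_of eI.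
Qed.

Lemma basis_extend I X : indep M I -> I \subset X ->
  exists J, [/\ indep M J, I \subset J, J \subset X & #|J| = r X].
Proof.
have [n] := ubnP (r X - #|I|); elim: n I => // n IHn I leI iI sIX.
have [K [iK sKX eK]] := rank_basis X.
have := indep_le_rank iI sIX; rewrite leq_eqVlt => /orP[/eqP eI|ltI].
  by exists I.
have [|y /setDP[yK yI] iyI] := indep_aug iI iK; first by rewrite eK.
have sy : y |: I \subset X by rewrite subUset sub1set sIX (subsetP sKX).
have [|J [iJ sJ sJX eJ]] := IHn (y |: I) _ iyI sy.
  by rewrite cardsU1 yI; lia.
by exists J; split=> //; apply: subset_trans sJ; apply: subsetUr.
Qed.

Lemma rank_le_card X : r X <= #|X|.
Proof. by have [I [_ /subset_leq_card sIX <-]] := rank_basis X. Qed.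

Lemma rankS X Y : X \subset Y -> r X <= r Y.
Proof.
move=> sXY; have [I [iI sIX <-]] := rank_basis X.
exact: indep_le_rank iI (subset_trans sIX sXY).
Qed.

Lemma rank_set0 : r set0 = 0.
Proof. by apply/eqP; rewrite -leqn0 -[X in _ <= X](cards0 T) rank_le_card. Qed.

Lemma indepE X : indep M X = (r X == #|X|).
Proof.
apply/idP/eqP => [iX | eX].
  by apply/eqP; rewrite eqn_leq rank_le_card indep_le_rank.
have [I [iI sIX eI]] := rank_basis X.
suff -> : X = I by [].
by apply/eqP; rewrite eq_sym eqEcard sIX eI eX /=.
Qed.

Lemma rank_submod A B : r (A :|: B) + r (A :&: B) <= r A + r B.
Proof.
have [I [iI sI eI]] := rank_basis (A :&: B).
have [J [iJ sIJ sJA eJ]] := basis_extend iI (subset_trans sI (subsetIl A B)).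
have [K [iK sJK sK eK]] :=
  basis_extend iJ (subset_trans sJA (subsetUl A B)).
have lA : #|K :&: A| <= r A.
  by apply: indep_le_rank (subsetIr _ _); apply: indep_down iK; apply: subsetIl.
have lB : #|K :&: B| <= r B.
  by apply: indep_le_rank (subsetIr _ _); apply: indep_down iK; apply: subsetIl.
have lAB : #|(K :&: A) :&: (K :&: B)| = r (A :&: B).
  apply/eqP; rewrite eqn_leq -{2}eI; apply/andP; split.
    apply: indep_le_rank; last by rewrite setIACA setIid subsetIr.
    by apply: indep_down iK; rewrite -setIA subsetIl.
  apply: subset_leq_card; rewrite setIACA setIid subsetI sI andbT.
  exact: subset_trans sIJ sJK.
have : #|(K :&: A) :|: (K :&: B)| = r (A :|: B).
  by rewrite -setIUr (setIidPl sK).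
by have := cardsUI (K :&: A) (K :&: B); lia.
Qed.

Lemma rank_sub A B C D : C \subset A -> C \subset B -> D \subset A :|: B ->
  r D + r C <= r A + r B.
Proof.
move=> sCA sCB sD; apply: leq_trans (rank_submod A B).
by apply: leq_add; apply: rankS; rewrite // subsetI sCA.
Qed.

Lemma rankU A B : r (A :|: B) <= r A + r B.
Proof. by apply: leq_trans (rank_submod A B); apply: leq_addr. Qed.

Lemma rankU1 x A : r (x |: A) <= (r A).+1.
Proof.
by apply: leq_trans (rankU _ _) _; have := rank_le_card [set x]; rewrite cards1; lia.
Qed.

Lemma rank_groundI X : r (X :&: ground M) = r X.
Proof.
apply/eqP; rewrite eqn_leq rankS ?subsetIl //=.
have [I [iI sIX <-]] := rank_basis X.
by apply: indep_le_rank; rewrite // subsetI sIX indep_ground.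
Qed.

Lemma rank_le_ground X : r X <= rank M.
Proof. by rewrite -rank_groundI rankS // subsetIr. Qed.

Lemma ground_of_rank x A : r A < r (x |: A) -> x \in ground M.
Proof.
apply: contraTT => xM; rewrite -leqNgt -rank_groundI.
apply: rankS; apply/subsetP=> z; rewrite !inE => /andP[/orP[/eqP->|//]].
by rewrite (negPf xM).
Qed.

Lemma rank_cl x A B : A \subset B -> r (x |: A) <= r A -> r (x |: B) = r B.
Proof.
move=> sAB h; apply/eqP; rewrite eqn_leq [r B <= _]rankS ?subsetUr // andbT.
have := @rank_sub (x |: A) B A (x |: B) (subsetUr _ _) sAB.
suff s : x |: B \subset x |: A :|: B by move/(_ s); lia.
by apply/subsetP=> z; rewrite !inE => /orP[->|->]; rewrite ?orbT.
Qed.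

Lemma rank_clU A B C : A \subset B -> (forall x, x \in C -> r (x |: A) <= r A) ->
  r (C :|: B) = r B.
Proof.
move=> sAB; have [n] := ubnP #|C|; elim: n C => // n IHn C leC clC.
have [->|[x xC]] := set_0Vmem C; first by rewrite set0U.
rewrite -(setD1K xC) -setUA (@rank_cl _ A) ?clC //; last first.
  by apply: subset_trans sAB _; apply: subsetUr.
apply: IHn => [|z /setD1P[_ /clC] //].
by move: leC; rewrite (cardsD1 x) xC; lia.
Qed.

Hypothesis sM : simple M.

Lemma simple_rank1 x : x \in ground M -> r [set x] = 1.
Proof.
move=> xM; have [/(_ x)] := sM; rewrite /loop xM /= negbK => i _.
by move: i; rewrite indepE cards1 => /eqP.
Qed.

Lemma simple_rank2 x y : x \in ground M -> y \in ground M -> x != y ->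
  r [set x; y] = 2.
Proof.
move=> xM yM nxy; have [nl /(_ x y)] := sM.
rewrite /parallel_pair xM yM nxy !nl /= negbK => i.
by move: i; rewrite indepE cards2 nxy => /eqP.
Qed.

End RankTheory.

Lemma simpleI (T : finType) (M : matroid T) :
  (forall x, x \in ground M -> 1 <= rank_of M [set x]) ->
  (forall x y, x \in ground M -> y \in ground M -> x != y ->
     2 <= rank_of M [set x; y]) -> simple M.
Proof.
move=> h1 h2; split=> [x|x y].
  apply/negP=> /andP[xM]; rewrite indepE cards1 => /negP[].
  by rewrite eqn_leq h1 // -(cards1 x) rank_le_card.
apply/negP=> /and5P[xM yM nxy _ /andP[_]]; rewrite indepE cards2 nxy => /negP[].
by rewrite eqn_leq h2 // andbT -[2]/((true).+1) -nxy -cards2 rank_le_card.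
Qed.

(** * Ranks in minors, and minors prescribed by a kept set and a contracted set *)

Section MinorRank.
Variable T : finType.
Implicit Types (M N : matroid T) (A X Z : {set T}).

Lemma minor_trans M N P : minor M N -> minor N P -> minor M P.
Proof.
move=> MN; elim=> // Q' e _ MQ eQ; first exact: minor_delete.
exact: minor_contract.
Qed.

Lemma rank_delete M e X : e \notin X -> rank_of (delete M e) X = rank_of M X.
Proof.
move=> eX; apply: eq_bigl => I /=; rewrite /del_indep.
case sI: (I \subset X); rewrite ?andbF // !andbT.
by rewrite (contra _ eX) //; apply: subsetP.
Qed.

Lemma rank_contract M e X : e \notin X ->
  rank_of (contract M e) X = rank_of M (e |: X) - rank_of M [set e].
Proof.
move=> eX; case ie: (indep M [set e]); last first.
  have re : rank_of M [set e] = 0.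
    move: ie; rewrite indepE cards1.
    by have := rank_le_card M [set e]; rewrite cards1; lia.
  have -> : rank_of M (e |: X) = rank_of M X.
    by apply: (@rank_cl _ _ _ set0); rewrite ?sub0set // setU0 re.
  rewrite re subn0 -(rank_delete M eX).
  by apply: eq_bigl => I /=; rewrite /con_indep ie.
have re : rank_of M [set e] = 1 by move: (ie); rewrite indepE cards1 => /eqP.
apply/eqP; rewrite re eqn_leq; apply/andP; split.
  have [I [iI sIX <-]] := rank_basis (contract M e) X.
  move: iI; rewrite /= /con_indep ie => /andP[eI iI].
  have := indep_le_rank iI (setUS [set e] sIX).
  by rewrite cardsU1 eI; lia.
have [J [iJ sJ sJX <-]] := basis_extend ie (subsetUl [set e] X).
have eJ : e \in J by rewrite -sub1set.
have sJX' : J :\ e \subset X by rewrite subDset.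
rewrite (cardsD1 e) eJ addKn; apply: indep_le_rank => //.
by rewrite /= /con_indep ie setD11 setD1K.
Qed.

Lemma rank_contractE M e X :
  rank_of (contract M e) X = rank_of M (e |: X) - rank_of M [set e].
Proof.
rewrite -[e |: X](setD1K (setU11 e X)) -rank_contract ?setD11 //.
rewrite -rank_groundI -[RHS]rank_groundI; congr rank_of.
by apply/setP=> z; rewrite !inE; case: (z == e); rewrite //= !andbF.
Qed.

(** The points outside A go one at a time: contracted when in Z, deleted otherwise. [Z] may be
    dependent; contracting a loop is then a deletion and the rank formula absorbs it. Monotonicity
    keeps the truncated subtractions exact. *)
Lemma minor_exists M A Z : A \subset ground M -> Z \subset ground M ->
  [disjoint A & Z] ->
  exists N, [/\ minor M N, ground N = A
    & forall X, X \subset A -> rank_of N X = rank_of M (X :|: Z) - rank_of M Z].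
Proof.
move=> sA sZ dAZ.
have [n] := ubnP #|ground M :\: A|; elim: n M sA Z sZ dAZ => // n IHn M sA Z sZ dAZ leM.
have [e0|[e]] := set_0Vmem (ground M :\: A).
  have gA : ground M = A by apply/eqP; rewrite eqEsubset sA -setD_eq0 e0 eqxx.
  have Z0 : Z = set0.
    apply/eqP; rewrite -subset0; apply/subsetP=> z zZ.
    by have := disjointFl dAZ zZ; rewrite -gA (subsetP sZ).
  exists M; split=> //; first exact: minor_refl.
  by move=> X _; rewrite Z0 setU0 rank_set0 subn0.
case/setDP=> eM eA.
have card_lt N : ground N = ground M :\ e -> #|ground N :\: A| < n.
  move=> ->; move: leM; rewrite (cardsD1 e) inE eM eA /=.
  by rewrite setDDl setUC -setDDl ltnS.
have sAe : A \subset ground M :\ e by rewrite subsetD1 sA.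
case eZ: (e \in Z); last first.
  have sZe : Z \subset ground (delete M e) by rewrite subsetD1 sZ eZ.
  have [|N [mN gN rN]] := IHn (delete M e) sAe Z sZe dAZ; first exact: card_lt.
  exists N; split=> //.
    by apply: minor_trans mN; apply: minor_delete => //; apply: minor_refl.
  move=> X sX; have eX : e \notin X by apply: contra eA; apply: subsetP.
  by rewrite rN // !rank_delete ?inE ?negb_or ?eX ?eZ.
have sZe : Z :\ e \subset ground (contract M e) by rewrite /= setSD.
have dZe : [disjoint A & Z :\ e].
  by move: dAZ; apply: contraTT => /pred0Pn[z /andP[zA /setD1P[_ zZ]]];
     apply/pred0Pn; exists z; apply/andP.
have [|N [mN gN rN]] := IHn (contract M e) sAe _ sZe dZe; first exact: card_lt.
exists N; split=> //.
  by apply: minor_trans mN; apply: minor_contract => //; apply: minor_refl.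
move=> X sX; have eX : e \notin X by apply: contra eA; apply: subsetP.
rewrite rN // !rank_contract ?inE ?negb_or ?eqxx ?eX //.
rewrite setUCA setD1K //.
have : rank_of M [set e] <= rank_of M Z by rewrite rankS // sub1set.
have : rank_of M Z <= rank_of M (X :|: Z) by rewrite rankS // subsetUr.
lia.
Qed.

Lemma restrict_exists M A : A \subset ground M ->
  exists N, [/\ minor M N, ground N = A
    & forall X, X \subset A -> rank_of N X = rank_of M X].
Proof.
move=> sA; have [|N [mN gN rN]] := @minor_exists M A set0 sA (sub0set _).
  by rewrite -setI_eq0 setI0.
by exists N; split=> // X sX; rewrite rN // setU0 rank_set0 subn0.
Qed.

Lemma has_minor_trans (U : finType) M N (P : matroid U) :
  minor M N -> has_minor N P -> has_minor M P.
Proof. by move=> MN [N' mN' iso]; exists N' => //; apply: minor_trans mN'. Qed.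

Lemma has_minor_embed n (N : matroid 'I_n) M (g : 'I_n -> T) :
  0 < n -> ground N = setT -> injective g ->
  (forall i, g i \in ground M) ->
  (forall Y : {set 'I_n}, indep M (g @: Y) = indep N Y) -> has_minor M N.
Proof.
case: n N g => // n N g _ gN injg gM ig.
have sA : g @: setT \subset ground M by apply/subsetP=> _ /imsetP[i _ ->].
have [M' [mM gM' rM]] := restrict_exists sA.
(* [f] inverts [g] on the minor; off the image of [g] it takes the default [ord0], which is why [n]
   was turned into a successor. *)
exists M' => //; pose f x := odflt ord0 [pick i | g i == x].
have fK i : f (g i) = i.
  rewrite /f; case: pickP => [j /eqP/injg //|/(_ i)]; by rewrite eqxx.
exists f; split.
- move=> x y; rewrite gM' => /imsetP[i _ ->] /imsetP[j _ ->].
  by rewrite !fK => ->.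
- rewrite gM' gN; apply/setP=> i; rewrite inE; apply/imsetP.
  by exists (g i); rewrite ?fK ?imset_f.
move=> X; rewrite gM' => sX.
have eX : X = g @: (f @: X).
  rewrite -imset_comp -[LHS]imset_id; apply: eq_in_imset => x /(subsetP sX).
  by case/imsetP=> i _ -> /=; rewrite fK.
by rewrite -ig -eX !indepE rM.
Qed.

End MinorRank.

(** * Ranks of explicit lists of points, and 3-element circuits *)

Definition rk (T : finType) (M : matroid T) (s : seq T) : nat :=
  rank_of M [set x in s].

(** A 3-element circuit expressed by ranks alone, so that it can be carried to a contraction by
    computing ranks. The lower bounds force three distinct points of the ground set. *)
Definition triangle (T : finType) (M : matroid T) (a b c : T) : bool :=
  [&& rk M [:: a; b; c] <= 2, 2 <= rk M [:: a; b], 2 <= rk M [:: a; c]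
    & 2 <= rk M [:: b; c]].

Section PointLists.
Variables (T : finType) (M : matroid T).
Implicit Types (s t : seq T) (a b c x : T).
Local Notation r := (rk M).

Lemma rk_leS s t : all [in t] s -> r s <= r t.
Proof. by move/allP=> st; apply: rankS; apply/subsetP=> x; rewrite !inE => /st. Qed.

Lemma rk_eq_mem s t : s =i t -> r s = r t.
Proof. by move=> e; congr rank_of; apply/setP=> x; rewrite !inE e. Qed.

Lemma rk_size s : r s <= size s.
Proof.
apply: leq_trans (rank_le_card _ _) _.
by rewrite cardsE card_size.
Qed.

Lemma set_seq_cons x s : [set z in x :: s] = x |: [set z in s].
Proof. by apply/setP=> z; rewrite !inE. Qed.

Lemma rk_cons x s : r (x :: s) <= (r s).+1.
Proof. by rewrite /rk set_seq_cons rankU1. Qed.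

Lemma rk_sub s t u v : all [in s] u -> all [in t] u -> all [in s ++ t] v ->
  r v + r u <= r s + r t.
Proof.
move=> /allP us /allP ut /allP vst; apply: rank_sub.
- by apply/subsetP=> x; rewrite !inE => /us.
- by apply/subsetP=> x; rewrite !inE => /ut.
by apply/subsetP=> x; rewrite !inE => /vst; rewrite mem_cat.
Qed.

Lemma rk1_ground a s : r s < r (a :: s) -> a \in ground M.
Proof. by rewrite /rk set_seq_cons => /ground_of_rank. Qed.

(** Two points of a circuit span the third, by submodularity. Adding all three points lets one
    equation serve the three cases; it is the inference rule behind [saturate] and [addt]. *)
Lemma rk_add a b c s : triangle M a b c ->
  [|| (a \in s) && (b \in s), (a \in s) && (c \in s) | (b \in s) && (c \in s)] ->
  r [:: a, b, c & s] = r s.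
Proof.
case/and4P=> abc ab ac bc h; apply/eqP; rewrite eqn_leq; apply/andP; split.
  case/or3P: h => /andP[h1 h2].
  - have := @rk_sub [:: a; b; c] s [:: a; b] [:: a, b, c & s].
    rewrite /= !inE !eqxx h1 h2 !orbT /= => /(_ isT isT).
    suff -> : all [in [:: a, b, c & s]] s by move=> /(_ isT); lia.
    by apply/allP=> x; rewrite !inE => ->; rewrite !orbT.
  - have := @rk_sub [:: a; b; c] s [:: a; c] [:: a, b, c & s].
    rewrite /= !inE !eqxx h1 h2 !orbT /= => /(_ isT isT).
    suff -> : all [in [:: a, b, c & s]] s by move=> /(_ isT); lia.
    by apply/allP=> x; rewrite !inE => ->; rewrite !orbT.
  have := @rk_sub [:: a; b; c] s [:: b; c] [:: a, b, c & s].
  rewrite /= !inE !eqxx h1 h2 !orbT /= => /(_ isT isT).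
  suff -> : all [in [:: a, b, c & s]] s by move=> /(_ isT); lia.
  by apply/allP=> x; rewrite !inE => ->; rewrite !orbT.
by apply: rk_leS; apply/allP=> x; rewrite !inE => ->; rewrite !orbT.
Qed.

Lemma rk2C a b : r [:: a; b] = r [:: b; a].
Proof. by apply: rk_eq_mem => x; rewrite !inE orbC. Qed.

Lemma rk3C a b c : r [:: a; b; c] = r [:: b; a; c].
Proof. by apply: rk_eq_mem => x; rewrite !inE orbCA. Qed.

Lemma rk3R a b c : r [:: a; b; c] = r [:: b; c; a].
Proof. by apply: rk_eq_mem => x; rewrite !inE orbC -orbA. Qed.

Lemma triangleC a b c : triangle M a b c = triangle M b a c.
Proof. by rewrite /triangle rk3C (rk2C a b) [X in [&& _, _ & X]]andbC. Qed.

Lemma triangleR a b c : triangle M a b c = triangle M b c a.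
Proof.
rewrite /triangle rk3R (rk2C b a) (rk2C c a).
by case: (2 <= r [:: a; b]); case: (2 <= r [:: a; c]); case: (2 <= r [:: b; c]); rewrite ?andbF.
Qed.

End PointLists.

(** * A computable certificate that a small matroid embeds in M *)

Section Embed.
Variables (n r : nat) (C rules seeds : seq (seq nat)).

Fixpoint subs (s : seq nat) : seq (seq nat) :=
  if s is x :: s' then [seq x :: t | t <- subs s'] ++ subs s' else [:: [::]].

Lemma mem_subs (p : pred nat) s : [seq x <- s | p x] \in subs s.
Proof.
elim: s => //= x s IHs; rewrite mem_cat; case: (p x); last by rewrite IHs orbT.
by rewrite map_f.
Qed.

Definition list_indep (s : seq nat) : bool :=
  (size s <= r) && all (fun c => ~~ all [in s] c) C.

Definition sat_step (s : seq nat) : seq nat :=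
  foldr (fun c t => if c is [:: i; j; k] then
     if [|| (i \in t) && (j \in t), (i \in t) && (k \in t)
          | (j \in t) && (k \in t)] then [:: i, j, k & t] else t
     else t) s rules.

(** A pass that changes the set of listed points adds one of the [n] points, so [n] passes reach the
    closure. *)
Definition saturate (s : seq nat) : seq nat :=
  iter n (fun t => undup (sat_step t)) s.

(* Seeds are sets known to have rank r, rules are known triangles: a set spans if
   closing it under the rules reaches a seed.  Every independent set has to extend
   to an r-element set that spans in this way. *)
Definition embed_check : bool :=
  let S := subs (iota 0 n) in
  let B := [seq t <- S | (size t == r)
     && (let u := saturate t in has (fun s => all [in u] s) seeds)] in
  [&& 0 < n, all (fun c => uniq c) C,
    all (fun s => (size s <= 2) ==> list_indep s) S
    & all (fun s => list_indep s ==> has (fun t => all [in t] s) B) S].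

Variables (T : finType) (M : matroid T) (pts : seq T).
Variable chk : circ_check n r C.

(** Dependent sets are easy: they contain a member of C or exceed the rank. An independent set
    extends to an r-element set whose saturation contains a seed; saturating keeps the rank, so this
    larger set is independent in M. Injectivity of [g] follows from the independence of pairs. *)
Lemma circ_embed (x0 : T) (g := nth x0 pts) :
  embed_check -> rank M <= r ->
  {in C, forall c, rk M (map g c) < size c} ->
  {in rules, forall c, if c is [:: i; j; k] then triangle M (g i) (g j) (g k)
                       else true} ->
  {in seeds, forall s, r <= rk M (map g s)} ->
  has_minor M (circ_matroid chk).
Proof.
case/and4P=> n_gt0 /allP uC /allP pairs /allP bases rM dC tri sd.
have satE s : rk M (map g (saturate s)) = rk M (map g s).
  rewrite /saturate; elim: n => //= m <-; move: (iter m _ s) => t.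
  have -> : rk M (map g (undup (sat_step t))) = rk M (map g (sat_step t)).
    by apply: rk_eq_mem => x; apply: eq_mem_map => y; rewrite mem_undup.
  rewrite /sat_step; move: tri; elim: (rules) => //= c R IHR tri.
  have {}IHR := IHR (fun c' c'R => tri c' (mem_behead (s := c :: R) c'R)).
  have {}tri := tri c (mem_head _ _).
  case: c tri => [|i [|j [|k [|? ?]]]] // tri; case: ifP => // h.
  rewrite /= rk_add ?IHR //.
  by case/or3P: h => /andP[h1 h2]; rewrite (map_f g h1) (map_f g h2) ?orbT.
have rk_ext t : t \in subs (iota 0 n) -> size t = r ->
    has (fun s => all [in saturate t] s) seeds -> rk M (map g t) = size t.
  move=> _ st /hasP[s s_sd /allP s_t].
  apply/eqP; rewrite eqn_leq -{1}(size_map g) rk_size /= st.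
  apply: leq_trans (sd _ s_sd) _; rewrite -(satE t); apply: rk_leS.
  by apply/allP=> _ /mapP[i /s_t i_t ->]; apply: map_f.
(* Listing Y in increasing order makes it literally a member of [subs (iota 0 n)], over which the
   check has run. *)
pose ls (Y : {set 'I_n}) := [seq i <- iota 0 n | i \in map val (enum Y)].
have ls_subs Y : ls Y \in subs (iota 0 n) by apply: mem_subs.
have mem_ls (Y : {set 'I_n}) (i : 'I_n) : (val i \in ls Y) = (i \in Y).
  by rewrite mem_filter mem_iota /= add0n ltn_ord andbT mem_map ?mem_enum //; exact: val_inj.
have size_ls Y : size (ls Y) = #|Y|.
  rewrite cardE -(size_map val); apply: perm_size; apply: uniq_perm.
  - by rewrite filter_uniq ?iota_uniq.
  - by rewrite map_inj_uniq ?enum_uniq //; exact: val_inj.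
  move=> i; rewrite mem_filter mem_iota add0n; apply: andb_idr => /mapP[j _ ->].
  exact: ltn_ord.
pose h (i : 'I_n) := g (val i).
have himg (Y : {set 'I_n}) : h @: Y = [set x in map g (ls Y)].
  apply/setP=> x; rewrite inE; apply/imsetP/mapP => [[i iY ->]|[i]].
    by exists (val i); rewrite ?mem_ls.
  rewrite mem_filter => /andP[/mapP[j]]; rewrite mem_enum => jY -> _ ->.
  by exists j.
have ltC c : c \in C -> forall i, i \in c -> i < n.
  by move=> cC; have /andP[/allP/(_ c cC)/andP[_ /allP]] := chk.
have circE (Y : {set 'I_n}) : circ_indep r C Y = list_indep (ls Y).
  rewrite /circ_indep /list_indep size_ls; congr (_ && _).
  apply: eq_in_all => c cC; congr (~~ _); apply/subsetP/allP => [sY i ic|sY i].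
    have ii := ltC _ cC _ ic.
    by change (val (Ordinal ii) \in ls Y); rewrite mem_ls sY // inE.
  by rewrite inE => /sY; rewrite /= mem_ls.
have good (Y : {set 'I_n}) : circ_indep r C Y -> rank_of M (h @: Y) = #|Y|.
  rewrite circE => iY; have := bases _ (ls_subs Y); rewrite iY /= => /hasP[t].
  rewrite mem_filter => /andP[/andP[/eqP st hs] t_s] /allP Yt.
  have rt := rk_ext _ t_s st hs.
  have ut : uniq (ls Y) by rewrite filter_uniq ?iota_uniq.
  apply/eqP; rewrite eqn_leq (leq_trans (rank_le_card _ _) (leq_imset_card _ _)) /=.
  (* [t'] is the part of the basis [t] outside Y. It raises the rank of Y by at most its size, and
     [t] has full rank, so Y has rank at least its own size. *)
  pose t' := [seq i <- t | i \notin ls Y].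
  have : rk M (map g t) <= rk M (map g (ls Y)) + size t'.
    apply: leq_trans (_ : rk M (map g (ls Y) ++ map g t') <= _).
      apply: rk_leS; apply/allP=> _ /mapP[i it ->]; rewrite /= mem_cat.
      case: (boolP (i \in ls Y)) => iY'; first by rewrite map_f.
      by rewrite [X in _ || X]map_f ?orbT // mem_filter iY'.
    rewrite -(size_map g); move: (map g t') => u.
    rewrite -(cats0 u); elim: u => [|x u IHu]; first by rewrite /= cats0 addn0.
    have -> : rk M (map g (ls Y) ++ (x :: u) ++ [::]) = rk M (x :: (map g (ls Y) ++ u ++ [::])).
      by apply: rk_eq_mem => z; rewrite !(inE, mem_cat); case: (z == x); rewrite ?orbT.
    by apply: leq_trans (rk_cons _ _ _) _; rewrite /= addnS ltnS.
  have : size (ls Y) + size t' <= size t.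
    have -> : size t' = count (predC [in ls Y]) t by rewrite size_filter.
    rewrite -(count_predC [in ls Y] t) leq_add2r -size_filter.
    by apply: uniq_leq_size => // i i_Y; rewrite mem_filter i_Y /= Yt.
  by rewrite rt himg -size_ls; rewrite -/(rk M (map g (ls Y))); lia.
have injh : injective h.
  move=> i j hij; apply/eqP; apply: contraT => nij.
  have iP : circ_indep r C [set i; j].
    rewrite circE; have := pairs _ (ls_subs [set i; j]).
    by rewrite size_ls cards2 nij.
  have := good _ iP; rewrite cards2 nij imsetU1 imset_set1 hij setUid.
  by have := rank_le_card M [set h j]; rewrite cards1; lia.
apply: (@has_minor_embed _ _ _ _ h) => //.
  move=> i; have iP : circ_indep r C [set i].
    rewrite circE; have := pairs _ (ls_subs [set i]).
    by rewrite size_ls cards1.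
  have := good _ iP; rewrite cards1 imset_set1 => r1.
  by apply: (@ground_of_rank _ M (h i) set0); rewrite setU0 r1 rank_set0.
move=> Y; rewrite indepE card_imset //=; apply/eqP/idP => [e|/good //].
apply/negPn/negP=> niY; move: niY; rewrite negb_and -ltnNge => /orP[ltr|].
  by have := leq_ltn_trans (leq_trans (rank_le_ground M (h @: Y)) rM) ltr;
     rewrite e ltnn.
case/allPn=> c cC; rewrite negbK => sc.
have := dC _ cC; rewrite -[size c](_ : #|circ_set n c| = _).
  have -> : rk M (map g c) = rank_of M (h @: circ_set n c).
    congr rank_of; apply/setP=> x; rewrite inE; apply/mapP/imsetP=> [[i ic ->]|[i ic ->]].
      by exists (Ordinal (ltC _ cC _ ic)); rewrite // inE.
    by exists (val i); move: ic; rewrite inE.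
  have iY : indep M (h @: Y) by rewrite indepE e card_imset.
  have := indep_down (imsetS h sc) iY; rewrite indepE card_imset // => /eqP->.
  by rewrite ltnn.
rewrite cardE -(size_map val); apply: perm_size; apply: uniq_perm.
- by rewrite map_inj_uniq ?enum_uniq //; exact: val_inj.
- exact: uC.
move=> i; apply/mapP/idP=> [[j]|ic]; first by rewrite mem_enum inE => jc ->.
by exists (Ordinal (ltC _ cC _ ic)); rewrite ?mem_enum ?inE.
Qed.
End Embed.

(** * Forbidden configurations in rank 3 *)

Record avoids (T : finType) (M : matroid T) : Prop := Avoids {
  avoids1 : ~ has_minor M M_1; avoids2 : ~ has_minor M M_2;
  avoids3 : ~ has_minor M M_3; avoids4 : ~ has_minor M M_4;
  avoids5 : ~ has_minor M M_5; avoids6 : ~ has_minor M M_6;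
  avoids7 : ~ has_minor M M_7; avoids8 : ~ has_minor M M_8;
  avoidsQ : ~ has_minor M Q }.

Lemma avoids_minor (T : finType) (M N : matroid T) :
  minor M N -> avoids M -> avoids N.
Proof.
by move=> mN [*]; split=> h; move: (has_minor_trans mN h).
Qed.

Lemma in_cons_all (A : eqType) (P : A -> Prop) x s :
  P x -> {in s, forall y, P y} -> {in x :: s, forall y, P y}.
Proof. by move=> Px Ps y; rewrite inE => /predU1P[->|/Ps]. Qed.

Lemma in_nil_all (A : eqType) (P : A -> Prop) : {in [::], forall y : A, P y}.
Proof. by []. Qed.

Ltac sym3 := first
 [ done | rewrite triangleC; done | rewrite triangleR; done
 | rewrite -triangleR; done | rewrite triangleC triangleR; done
 | rewrite triangleC -triangleR; done
 | rewrite rk3C; done | rewrite rk3R; done | rewrite -rk3R; done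
 | rewrite rk3C rk3R; done | rewrite rk3C -rk3R; done ].

(** [addt t; seed i] bounds the rank of a list from below: adding the points of the triangle [t],
    two of which are listed, keeps the rank, and the enlarged list contains the one whose rank is
    bounded by [i]. *)
Ltac addt t := rewrite -(rk_add t); last by rewrite !inE ?eqxx ?orbT.
Ltac seed known_ind := refine (leq_trans known_ind (rk_leS _ _));
  by rewrite /= !inE ?eqxx ?orbT.

Ltac each tac := repeat (apply: in_cons_all; first by rewrite /=; tac);
  exact: in_nil_all.

(** When every listed circuit is a triangle, the same list serves as the dependencies and as the
    saturation rules. *)
Lemma circ_embed3 n (C seeds : seq (seq nat)) (chk : circ_check n 3 C)
    (T : finType) (M : matroid T) (x0 : T) (pts : seq T) (g := nth x0 pts) :
  all (fun c => size c == 3) C && embed_check n 3 C C seeds -> rank M <= 3 ->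
  {in C, forall c, if c is [:: i; j; k] then triangle M (g i) (g j) (g k)
                   else true} ->
  {in seeds, forall s, 3 <= rk M (map g s)} ->
  has_minor M (circ_matroid chk).
Proof.
case/andP=> /allP C3 chk' rM tri sd; apply: (circ_embed _ chk' rM _ tri sd).
move=> c cC; have := tri c cC; have := C3 c cC.
by case: c {cC} => [|i [|j [|k [|? ?]]]] // _ /and4P[].
Qed.

Section Plane.
Variables (T : finType) (M : matroid T).
Hypotheses (avM : avoids M) (rM : rank M <= 3).
Local Notation tri := (triangle M).
Local Notation ind3 a b c := (2 < rk M [:: a; b; c]).

Lemma ind3_pair a b c : ind3 a b c -> 1 < rk M [:: b; c].
Proof. by have := rk_cons M a [:: b; c]; clear; lia. Qed.

(** Each pair is independent because it sits in some independent triple; [u], [v], [w] are arbitrary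
    witnesses of this. *)
Lemma collinear_triangle u v w a b c :
  ind3 u a b -> ind3 v a c -> ind3 w b c -> ~~ ind3 a b c -> tri a b c.
Proof.
move=> /ind3_pair h1 /ind3_pair h2 /ind3_pair h3; rewrite -leqNgt => h.
exact/and4P.
Qed.

(** This is [M_4], with [e] playing the part of g. One seed is enough, since the four lines generate
    every other basis from it. *)
Lemma no_complete_quadrilateral a b c d e h :
  tri a b c -> tri a d h -> tri b e h -> tri c d e -> ind3 a b h -> False.
Proof.
move=> t1 t2 t3 t4 i1; apply: (avoids4 avM).
apply: (@circ_embed3 _ _ [:: [:: 0; 1; 5]] check4 _ _ a [:: a; b; c; d; e; h]).
- by vm_compute.
- exact: rM.
- each sym3.
each sym3.
Qed.

Section Triangle.

(* The corners are a, b, h; the points c, d, e lie on the sides ab, ah, bh, and f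
   is off the three sides. *)
Lemma triangle_extra_median a b c d e h f :
  tri a b c -> tri a d h -> tri b e h -> ind3 a b h ->
  ind3 a b f -> ind3 a h f -> ind3 b h f -> ind3 c d e -> tri c h f ->
  ind3 b d f -> ind3 a e f -> False.
Proof.
move=> t1 t2 t3 i0 f1 f2 f3 i1 t4 i2 i3.
have f4 : ind3 a d f.
  by addt t2; seed f2.
have f5 : ind3 b e f.
  by addt t3; seed f3.
case i4: (ind3 d e f); last first.
  have t5 : tri d e f.
    by apply: (@collinear_triangle c a b); rewrite ?i4 //.
  apply: (avoids6 avM).
  apply: (@circ_embed3 _ _ [:: [:: 0; 1; 6]; [:: 0; 1; 5]; [:: 0; 6; 5]; [:: 1; 6; 5];
   [:: 2; 3; 4]; [:: 1; 3; 5]; [:: 0; 4; 5]] check6 _ _ a [:: a; b; c; d; e; f; h]).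
  - by vm_compute.
  - exact: rM.
  - each sym3.
  each sym3.
apply: (avoids5 avM).
apply: (@circ_embed3 _ _ [:: [:: 0; 1; 6]; [:: 0; 1; 5]; [:: 0; 6; 5]; [:: 1; 6; 5];
   [:: 2; 3; 4]; [:: 1; 3; 5]; [:: 0; 4; 5]; [:: 3; 4; 5]]
   check5 _ _ a [:: a; b; c; d; e; f; h]).
- by vm_compute.
- exact: rM.
- each sym3.
each sym3.
Qed.

(** Here [f] lies on none of the lines ch, bd, ae, nor on cd or de. Only the line ce is left:
    through [f] it gives [M_7], otherwise [M_8]. *)
Lemma triangle_extra_generic a b c d e h f :
  tri a b c -> tri a d h -> tri b e h -> ind3 a b h ->
  ind3 a b f -> ind3 a h f -> ind3 b h f -> ind3 c d e -> ind3 c h f ->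
  ind3 b d f -> ind3 a e f -> ind3 c d f -> ind3 d e f -> False.
Proof.
move=> t1 t2 t3 i0 f1 f2 f3 i1 i2 i3 i4 i5 i6.
case i7: (ind3 c e f).
  apply: (avoids8 avM).
  apply: (@circ_embed3 _ _ [:: [:: 0; 1; 6]; [:: 0; 1; 5]; [:: 0; 6; 5]; [:: 1; 6; 5];
   [:: 2; 3; 4]; [:: 1; 3; 5]; [:: 0; 4; 5]; [:: 2; 6; 5]; [:: 2; 3; 5]; [:: 3; 4; 5];
   [:: 2; 4; 5]] check8 _ _ a [:: a; b; c; d; e; f; h]).
  - by vm_compute.
  - exact: rM.
  - each sym3.
  each sym3.
have t5 : tri c e f.
  by apply: (@collinear_triangle d d d); rewrite ?i7 //; sym3.
apply: (avoids7 avM).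
apply: (@circ_embed3 _ _ [:: [:: 0; 1; 6]; [:: 0; 1; 5]; [:: 0; 6; 5]; [:: 1; 6; 5];
   [:: 2; 3; 4]; [:: 1; 3; 5]; [:: 0; 4; 5]; [:: 2; 6; 5]; [:: 2; 3; 5]; [:: 3; 4; 5]]
    check7 _ _ a [:: a; b; c; d; e; f; h]).
- by vm_compute.
- exact: rM.
- each sym3.
each sym3.
Qed.

Variables a b c d e h f : T.

(** If c, d, e are collinear, the sides and their line form an [M_4]. Otherwise count the lines ch,
    bd, ae through [f]: two of them give [M_4], exactly one gives [M_5] or [M_6], and none gives
    [M_7] or [M_8], after a symmetry that moves a side of cde through [f], if any, to ce. *)
Lemma no_triangle_extra :
  tri a b c -> tri a d h -> tri b e h -> ind3 a b h ->
  ind3 a b f -> ind3 a h f -> ind3 b h f -> False.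
Proof.
move=> t1 t2 t3 i0 f1 f2 f3.
have p1 : ind3 a c d by addt t1; addt t2; seed i0.
have p2 : ind3 b c e by addt t1; addt t3; seed i0.
have p3 : ind3 h d e by addt t2; addt t3; seed i0.
have p4 : ind3 a c f by addt t1; seed f1.
have p5 : ind3 a c h by addt t1; seed i0.
have p6 : ind3 a b d by addt t2; seed i0.
have p7 : ind3 a d f by addt t2; seed f2.
have p8 : ind3 b a e by addt t3; seed i0.
have p9 : ind3 b e f by addt t3; seed f3.
have p10 : ind3 h a e by addt t3; seed i0.
case i1: (ind3 c d e); last first.
  apply: (@no_complete_quadrilateral a b c d e h) => //.
  by apply: (@collinear_triangle a b h); rewrite ?i1.
have ta : ~~ ind3 c h f -> tri c h f by apply: (@collinear_triangle a a a).
have tb : ~~ ind3 b d f -> tri b d f by apply: (@collinear_triangle a a a).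
have tc : ~~ ind3 a e f -> tri a e f.
  by apply: (@collinear_triangle b b b) => //; rewrite rk3C.
have [ia|/ta {}ta] := boolP (ind3 c h f); last first.
  have [ib|/tb {}tb] := boolP (ind3 b d f); last first.
    by apply: (@no_complete_quadrilateral a b c h f d) => //; sym3.
  have [ic|/tc {}tc] := boolP (ind3 a e f); last first.
    by apply: (@no_complete_quadrilateral b a c h f e) => //; sym3.
  exact: (@triangle_extra_median a b c d e h f).
have [ib|/tb {}tb] := boolP (ind3 b d f); last first.
  have [ic|/tc {}tc] := boolP (ind3 a e f); last first.
    by apply: (@no_complete_quadrilateral h a d b f e) => //; sym3.
  by apply: (@triangle_extra_median a h d c e b f) => //; sym3.
have [ic|/tc {}tc] := boolP (ind3 a e f); last first.
  by apply: (@triangle_extra_median b h e c d a f) => //; sym3.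
have [i2|i2] := boolP (ind3 c d f); last first.
  have t4 : tri c d f by apply: (@collinear_triangle a a a).
  apply: (@triangle_extra_generic b a c e d h f) => //; try sym3.
    by addt t4; seed i1.
  by addt t4; seed i1.
have [i3|i3] := boolP (ind3 d e f); last first.
  have t4 : tri d e f by apply: (@collinear_triangle h a b).
  apply: (@triangle_extra_generic a h d c e b f) => //; try sym3.
  by addt t4; seed i1.
exact: (@triangle_extra_generic a b c d e h f).
Qed.

End Triangle.

Section Grid.
Variables (I : eqType) (x : I -> T) (y : I -> bool -> T).
(* The points x i are collinear, and y i true, y i false are two further points of
   another line through x i. *)
Hypothesis tx : forall i j k, uniq [:: i; j; k] -> tri (x i) (x j) (x k).
Hypothesis ty : forall i b, tri (x i) (y i b) (y i (~~ b)).
Hypothesis off : forall i j k b, i != j -> ind3 (x i) (x j) (y k b).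

Let uniqE (i j k : I) : uniq [:: i; j; k] = [&& i != j, i != k & j != k].
Proof. by rewrite /= !inE negb_or andbT -andbA. Qed.

(** Suppose the lines through [x i] and [x j] meet in w. In the triangle with corners [x i], [x j],
    w, each of the two points [y k _] must lie on a side through w, and they lie on different ones;
    then the two sides, the line of the points [x] and the line of the [y k _] form an [M_4]. *)
Lemma grid_disjoint i j k b c : uniq [:: i; j; k] -> ind3 (x i) (y i b) (y j c).
Proof.
move=> u; have /and3P[nij nik njk] : [&& i != j, i != k & j != k] by rewrite -uniqE.
apply/negPn/negP=> col; set w := y j c in col.
have [tj ti] := (ty j c, ty i b).
have iw : ind3 (x i) (x j) w by apply: off.
have rxw : 1 < rk M [:: x i; w].
  by apply: (@ind3_pair (x j)); rewrite rk3C.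
(* The point w may be parallel to one of the two points [y i _]; [d] selects one that is not. *)
have [d tw] : exists d, tri (x i) (y i d) w.
  have c2 d : rk M [:: x i; y i d; w] <= 2.
    have [->|->] : d = b \/ d = ~~ b by case: (d) (b) => [] []; auto.
      by rewrite leqNgt.
    rewrite leqNgt; apply: contra col => h; rewrite -(rk_add ti).
      by apply: leq_trans h (rk_leS _ _); rewrite /= !inE !eqxx ?orbT.
    by rewrite !inE !eqxx ?orbT.
  have [h|h] := boolP (1 < rk M [:: y i b; w]).
    by exists b; rewrite /triangle c2 rxw h; case/and4P: ti => _ ->.
  exists (~~ b); rewrite /triangle c2 rxw; case/and4P: ti => _ _ -> h3 /=.
  apply: contraT => h4.
  have := @rk_sub _ M [:: y i b; w] [:: y i (~~ b); w] [:: w] [:: y i b; y i (~~ b)].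
  rewrite /= !inE !eqxx !orbT => /(_ isT isT isT).
  by have := rk_cons M (x i) [:: w]; lia.
have tj' : tri (x j) (y j (~~ c)) w by sym3.
have txx := tx u.
have ex d0 : ~~ ind3 (x i) w (y k d0) || ~~ ind3 (x j) w (y k d0).
  rewrite -negb_and; apply/negP=> /andP[h1 h2].
  apply: (@no_triangle_extra (x i) (x j) (x k) (y i d) (y j (~~ c)) w (y k d0)) => //.
  exact: off.
(* Both points [y k _] on the side through [x i'] would put [x i'] on the line spanned by them,
   against [off]. *)
have no2 i' j' d0 : uniq [:: i'; j'; k] -> 1 < rk M [:: x i'; w] ->
    ~~ ind3 (x i') w (y k d0) -> ind3 (x i') w (y k (~~ d0)).
  move=> u' rw h1; apply: contraT => h2.
  have /and3P[n1 n2 n3] : [&& i' != j', i' != k & j' != k] by rewrite -uniqE.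
  have := @rk_sub _ M [:: x i'; w; y k d0] [:: x i'; w; y k (~~ d0)] [:: x i'; w]
     [:: x i'; y k d0; y k (~~ d0)].
  rewrite /= !inE !eqxx !orbT => /(_ isT isT isT).
  have : ind3 (x i') (y k d0) (y k (~~ d0)).
    by addt (ty k d0); have h3 := off k d0 n2; seed h3.
  by move: rw h1 h2; clear; lia.
have u' : uniq [:: j; i; k] by rewrite uniqE eq_sym nij njk nik.
have rxw' : 1 < rk M [:: x j; w] by apply: (@ind3_pair (x i)).
have quad d0 : ~~ ind3 (x i) w (y k d0) -> False.
  move=> h1; have h2 := no2 i j d0 u rxw h1.
  have h3 : ~~ ind3 (x j) w (y k (~~ d0)) by have := ex (~~ d0); rewrite h2.
  have h4 := no2 j i (~~ d0) u' rxw' h3; rewrite negbK in h4.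
  apply: (@no_complete_quadrilateral (x i) (x j) (x k) (y k d0) (y k (~~ d0)) w) => //.
    apply: (@collinear_triangle (x j) (x j) (x j)); try by sym3.
    by have h5 := off k d0 nij; sym3.
  apply: (@collinear_triangle (x i) (x i) (x i)); try by sym3.
  exact: off.
have [h|h] := boolP (ind3 (x i) w (y k true)); last exact: quad h.
have h1 : ~~ ind3 (x j) w (y k true) by have := ex true; rewrite h.
have h2 := no2 j i true u' rxw' h1.
have h3 : ~~ ind3 (x i) w (y k false) by have := ex false; rewrite h2 orbF.
exact: quad h3.
Qed.

(** A collinear triple would make [y k c] a point on the side from [x i] to [y j b] of the triangle
    [x i], [x j], [y j b]. The other sides carry [x k] and [y j (~~ b)], and [y i true] is an extra
    point off all three. *)
Lemma grid_no_cross i j k b c : uniq [:: i; j; k] -> ind3 (x i) (y j b) (y k c).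
Proof.
move=> u; have /and3P[nij nik njk] : [&& i != j, i != k & j != k] by rewrite -uniqE.
have u1 : uniq [:: j; i; k] by rewrite uniqE eq_sym nij njk nik.
have u2 : uniq [:: j; k; i] by rewrite uniqE njk eq_sym nij eq_sym nik.
apply/negPn/negP=> col.
have h1 := off j b nij; have h2 := off k c nij.
have h3 := grid_disjoint b c u2.
have h4 := grid_disjoint b true u1; have h5 := grid_disjoint true b u.
have t : tri (x i) (y j b) (y k c).
  by apply: (@collinear_triangle (x j) (x j) (x j)) => //; sym3.
have tj := ty j b; have h6 := off i true nij; have txx := tx u.
by apply: (@no_triangle_extra (x i) (x j) (x k) (y k c) (y j (~~ b)) (y j b)
  (y i true)) => //; sym3.
Qed.

(** Two collinear transversals through [y i b] would be two sides of the triangle [y i b], [y j c],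
    [y j (~~ c)], whose third side contains [x j]; then [x i] is a point off the three sides. *)
Lemma grid_transversals i j k b c d : uniq [:: i; j; k] ->
  ~~ ind3 (y i b) (y j c) (y k d) -> ind3 (y i b) (y j (~~ c)) (y k (~~ d)).
Proof.
move=> u; have /and3P[nij nik njk] : [&& i != j, i != k & j != k] by rewrite -uniqE.
have u1 : uniq [:: j; i; k] by rewrite uniqE eq_sym nij njk nik.
have u2 : uniq [:: j; k; i] by rewrite uniqE njk eq_sym nij eq_sym nik.
have u3 : uniq [:: i; k; j] by rewrite uniqE nik nij eq_sym njk.
have mk c' d' : ~~ ind3 (y i b) (y j c') (y k d') -> tri (y i b) (y j c') (y k d').
  by apply: (@collinear_triangle (x i) (x i) (x j)); apply: grid_disjoint;
     eassumption.
move=> /mk t1; apply: contraT => /mk t2.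
have tj := ty j c.
have h1 := grid_disjoint b c u; have h2 := grid_disjoint b (~~ c) u.
have h3 := off j c nij.
have h4 := grid_disjoint c b u1.
exfalso; apply: (@no_triangle_extra (y i b) (y j c) (y k d) (y k (~~ d)) (x j)
  (y j (~~ c)) (x i)) => //; try by sym3.
  by addt tj; seed h4.
by addt tj; seed h3.
Qed.

(** The only collinearities not yet decided are transversals, one [y] from each line. By
    [grid_transversals] a second collinear one must be complementary to the first, so none, one or
    two give [M_1], [M_2] or [M_3]. *)
Lemma no_grid (i j k : I) : uniq [:: i; j; k] -> False.
Proof.
move=> u; have /and3P[nij nik njk] : [&& i != j, i != k & j != k] by rewrite -uniqE.
have u1 : uniq [:: j; i; k] by rewrite uniqE eq_sym nij njk nik.
have u2 : uniq [:: j; k; i] by rewrite uniqE njk eq_sym nij eq_sym nik.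
have u3 : uniq [:: i; k; j] by rewrite uniqE nik nij eq_sym njk.
have u4 : uniq [:: k; i; j] by rewrite uniqE !(eq_sym k) nik nij njk.
have u5 : uniq [:: k; j; i] by rewrite uniqE !(eq_sym k) (eq_sym j i) nik nij njk.
pose pts b c d := [:: x i; x j; x k; y i b; y j c; y k d;
                      y i (~~ b); y j (~~ c); y k (~~ d)].
(* The order matters for [sd1]: 3 triples settled by [off], then 12 by [grid_disjoint], then 12 by
   [grid_no_cross]. *)
pose S1 := [:: [:: 0; 1; 3]; [:: 0; 1; 4]; [:: 0; 1; 5];
  [:: 0; 3; 4]; [:: 0; 3; 7]; [:: 0; 3; 5]; [:: 0; 3; 8];
  [:: 1; 4; 3]; [:: 1; 4; 6]; [:: 1; 4; 5]; [:: 1; 4; 8];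
  [:: 2; 5; 3]; [:: 2; 5; 6]; [:: 2; 5; 4]; [:: 2; 5; 7];
  [:: 0; 4; 5]; [:: 0; 4; 8]; [:: 0; 7; 5]; [:: 0; 7; 8];
  [:: 1; 3; 5]; [:: 1; 3; 8]; [:: 1; 6; 5]; [:: 1; 6; 8];
  [:: 2; 3; 4]; [:: 2; 3; 7]; [:: 2; 6; 4]; [:: 2; 6; 7]].
have sd1 b c d : {in S1, forall s, 2 < rk M (map (nth (x i) (pts b c d)) s)}.
  by do 3![apply: in_cons_all; first by apply: off];
     do 12![apply: in_cons_all; first by apply: grid_disjoint; eassumption];
     do 12![apply: in_cons_all; first by apply: grid_no_cross].
have cat_all (A B : seq (seq nat)) (P : seq nat -> Prop) :
    {in A, forall s, P s} -> {in B, forall s, P s} -> {in A ++ B, forall s, P s}.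
  by move=> hA hB s; rewrite mem_cat => /orP[/hA|/hB].
have txx := tx u.
have [/existsP[b /existsP[c /existsP[d col]]]|/existsPn none] :=
  boolP [exists b, exists c, exists d, ~~ ind3 (y i b) (y j c) (y k d)].
  have [[ti tj] tk] := (ty i b, ty j c, ty k d).
  have t1 : tri (y i b) (y j c) (y k d).
    by apply: (@collinear_triangle (x i) (x i) (x j)) col; apply: grid_disjoint;
       eassumption.
  have n1 := grid_transversals u col.
  have n2 : ind3 (y i (~~ b)) (y j c) (y k (~~ d)).
    by rewrite rk3C; apply: (grid_transversals u1); rewrite rk3C.
  have n3 : ind3 (y i (~~ b)) (y j (~~ c)) (y k d).
    by rewrite -rk3R; apply: (grid_transversals u4); rewrite rk3R.
  have [col'|col'] := boolP (ind3 (y i (~~ b)) (y j (~~ c)) (y k (~~ d))).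
    apply: (avoids2 avM).
    apply: (@circ_embed3 _ _ (S1 ++ [:: [:: 3; 7; 8]; [:: 6; 4; 8]; [:: 6; 7; 5];
      [:: 6; 7; 8]]) check2 _ _ (x i) (pts b c d)).
    - by vm_compute.
    - exact: rM.
    - each sym3.
    apply: cat_all (sd1 b c d) _; each sym3.
  have t2 : tri (y i (~~ b)) (y j (~~ c)) (y k (~~ d)).
    by apply: (@collinear_triangle (x i) (x i) (x j)) col'; apply: grid_disjoint;
       eassumption.
  apply: (avoids3 avM).
  apply: (@circ_embed3 _ _ (S1 ++ [:: [:: 3; 7; 8]; [:: 6; 4; 8]; [:: 6; 7; 5]])
    check3 _ _ (x i) (pts b c d)).
  - by vm_compute.
  - exact: rM.
  - each sym3.
  apply: cat_all (sd1 b c d) _; each sym3.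
have nt b c d : ind3 (y i b) (y j c) (y k d).
  by have /existsPn/(_ c)/existsPn/(_ d) := none b; rewrite negbK.
have [[ti tj] tk] := (ty i true, ty j true, ty k true).
apply: (avoids1 avM).
apply: (@circ_embed3 _ _ (S1 ++ [:: [:: 3; 4; 5]; [:: 3; 4; 8]; [:: 3; 7; 5];
  [:: 3; 7; 8]; [:: 6; 4; 5]; [:: 6; 4; 8]; [:: 6; 7; 5]; [:: 6; 7; 8]])
  check1 _ _ (x i) (pts true true true)).
- by vm_compute.
- exact: rM.
- each sym3.
by apply: cat_all (sd1 _ _ _) _; do 8![apply: in_cons_all; first exact: nt].
Qed.

End Grid.
End Plane.

(** * Forbidden configurations in rank 4 *)

Lemma rk_contract (T : finType) (M : matroid T) u s :
  rk (contract M u) s = rk M (u :: s) - rk M [:: u].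
Proof.
rewrite /rk rank_contractE !set_seq_cons; congr (_ - rank_of M _).
by apply/setP=> z; rewrite !inE orbF.
Qed.

Ltac mem_solve := rewrite /= ?inE ?eqxx ?orbT.

Section Space.
Variables (T : finType) (M : matroid T).
Hypotheses (avM : avoids M) (rM : rank M <= 4).
Local Notation tri := (triangle M).
Variables (I : eqType) (x : I -> T) (y : I -> bool -> T).
Hypothesis tx : forall i j k, uniq [:: i; j; k] -> tri (x i) (x j) (x k).
Hypothesis ty : forall i b, tri (x i) (y i b) (y i (~~ b)).
Hypothesis off : forall i j i' j' b c, i != j -> i' != j' ->
  3 < rk M [:: x i'; x j'; y i b; y j c].

Let uniqE (i j k : I) : uniq [:: i; j; k] = [&& i != j, i != k & j != k].
Proof. by rewrite /= !inE negb_or andbT -andbA. Qed.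

Lemma rk_triangle_cons p a b c : tri a b c -> rk M [:: p; a; b; c] <= 3.
Proof.
move=> t; apply: leq_trans (rk_size M [:: p; a; b]).
rewrite -(rk_add (s := [:: p; a; b]) t).
  by apply: rk_leS; mem_solve.
by mem_solve.
Qed.

Lemma rk_nonloop p s : rk M s < rk M (p :: s) -> rk M [:: p] = 1.
Proof.
move=> h; apply/eqP; rewrite eqn_leq rk_size /=; apply: contraT.
have := @rk_sub _ M [:: p] s [::] (p :: s) isT isT; rewrite /= mem_head /=.
suff -> : all [in p :: s] s by move/(_ isT); move: h; clear; lia.
by apply/allP=> z zs; rewrite inE zs orbT.
Qed.

Lemma rk_drop1 a s : 3 < rk M (a :: s) -> 2 < rk M s.
Proof. by have := rk_cons M a s; clear; lia. Qed.

(** Contract [y i b]. The dependent quadruple becomes a line through [x i], [y j c], [y k d] in rank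
    3, where independence of the three [y] keeps the last two from being parallel. With [y k (~~ d)]
    this is either a triangle with an extra point or a complete quadrilateral. *)
Lemma no_space_cross i j k b c d : uniq [:: i; j; k] ->
  rk M [:: x i; y i b; y j c; y k d] <= 3 -> 2 < rk M [:: y i b; y j c; y k d] ->
  False.
Proof.
move=> u dep ind; have /and3P[nij nik njk] : [&& i != j, i != k & j != k] by rewrite -uniqE.
have u1 : uniq [:: j; k; i] by rewrite uniqE njk eq_sym nij eq_sym nik.
have [[ti tj] tk] := (ty i b, ty j c, ty k d).
have txx := tx u; have txx' := tx u1.
pose p := y i b; pose N := contract M p.
have rp : rk M [:: p] = 1.
  apply: (@rk_nonloop _ [:: x i; x j; y j c]).
  apply: (@leq_ltn_trans 3); first exact: rk_size.
  apply: leq_trans (off b c nij nij) (rk_leS _ _).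
  by mem_solve.
have pM : p \in ground M by apply: (@rk1_ground _ _ p [::]); rewrite rp; have := rk_size M [::].
have mN : minor M N by apply: minor_contract; first exact: minor_refl.
have avN : avoids N by apply: avoids_minor mN avM.
have rN s : rk N s = (rk M (p :: s)).-1 by rewrite rk_contract rp subn1.
have rkN : rank N <= 3.
  have r1 : rank_of M [set p] = 1.
    by rewrite -rp; congr rank_of; apply/setP=> z; rewrite !inE.
  rewrite [rank N]/rank /N rank_contractE r1 leq_subLR.
  exact: leq_trans (rank_le_ground _ _) rM.
have le3 s : 2 < rk M (p :: s) -> 1 < rk N s by rewrite rN; clear; lia.
have le4 s : 3 < rk M (p :: s) -> 2 < rk N s by rewrite rN; clear; lia.
have ge4 s : rk M (p :: s) <= 3 -> rk N s <= 2 by rewrite rN; clear; lia.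
have off3 i' j' l c' : i != l -> i' != j' -> 3 < rk M [:: p; x i'; x j'; y l c'].
  move=> n1 n2; apply: leq_trans (off b c' n1 n2) (rk_leS _ _).
  by mem_solve.
have off2 i' l c' : i != l -> 2 < rk M [:: p; x i'; y l c'].
  move=> n1; have [j' nj'] : exists j', j' != i'.
    by have [e|] := eqVneq i i'; [exists j; rewrite -e eq_sym | exists i].
  apply: (@rk_drop1 (x j')); apply: leq_trans (off3 _ _ _ c' n1 nj') (rk_leS _ _).
  by mem_solve.
have offx i' j' : i' != j' -> 2 < rk M [:: p; x i'; x j'].
  move=> n1; apply: (@rk_drop1 (y j c)).
  by apply: leq_trans (off3 _ _ _ c nij n1) (rk_leS _ _); mem_solve.
have tyN l c' : i != l -> triangle N (x l) (y l c') (y l (~~ c')).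
  move=> n1; have h := off2 l l c' n1.
  apply/and4P; split; [apply: ge4 | apply: le3 => // | apply: le3; exact: off2 | apply: le3].
    exact: rk_triangle_cons.
  by addt (ty l c'); seed h.
have txN i' j' k' : uniq [:: i'; j'; k'] -> triangle N (x i') (x j') (x k').
  move=> u'; have := tx u'; move: u'; rewrite uniqE => /and3P[n1 n2 n3] t.
  by apply/and4P; split; [apply: ge4; exact: rk_triangle_cons | | | ];
     apply: le3; apply: offx.
have t4 : triangle N (x i) (y j c) (y k d).
  apply/and4P; split; [apply: ge4 | | | ]; try by apply: le3; rewrite // off2.
  by apply: leq_trans dep; apply: rk_leS; mem_solve.
have [tjN tkN txxN] := And3 (tyN j c nij) (tyN k d nik) (txN _ _ _ u).
pose f := y k (~~ d).
have i1 : 2 < rk N [:: x i; x j; y j c] by apply: le4; apply: off3.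
have i2 : 2 < rk N [:: x i; x j; f] by apply: le4; apply: off3.
have i3 : 2 < rk N [:: x i; y j c; f].
  by addt t4; addt tkN; addt txxN; seed i1.
have [i4|i4] := boolP (2 < rk N [:: x j; y j c; f]).
  by apply: (@no_triangle_extra _ N avN rkN (x i) (x j) (x k) (y k d)
    (y j (~~ c)) (y j c) f) => //; sym3.
have t5 : triangle N (x j) (y j c) f.
  by apply: (@collinear_triangle _ N (x i) (x i) (x i)).
have i5 : 2 < rk N [:: x j; x k; f] by apply: le4; apply: off3.
by apply: (@no_complete_quadrilateral _ N avN rkN (x j) (x k) (x i)
  (y j c) (y k d) f) => //; sym3.
Qed.

Lemma space_generic i j k b c d : uniq [:: i; j; k] ->
  3 < rk M [:: x i; y i b; y j c; y k d].
Proof.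
move=> u; rewrite ltnNge; apply/negP=> dep.
have /and3P[nij nik njk] : [&& i != j, i != k & j != k] by rewrite -uniqE.
have [ind|ind] := boolP (2 < rk M [:: y i b; y j c; y k d]).
  exact: no_space_cross u dep ind.
(* Here [y i b] lies on the line of [y j c] and [y k d]. Replacing it by [y i (~~ b)] restores
   independence and stays in the same plane, so [no_space_cross] applies to the other choice of
   [b]. *)
pose v := [:: y i b; y i (~~ b); y j c; y k d].
have r1 : 1 < rk M [:: y j c; y k d].
  have h := off c d njk nij; have := rk_cons M (x i) [:: x j; y j c; y k d].
  by have := rk_cons M (x j) [:: y j c; y k d]; move: h; clear; lia.
have r2 : rk M v <= rk M [:: y i (~~ b); y j c; y k d].
  have := @rk_sub _ M [:: y i b; y j c; y k d] [:: y i (~~ b); y j c; y k d]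
    [:: y j c; y k d] v.
  by mem_solve => /(_ isT isT isT); move: r1 ind; clear; lia.
have r3 : 2 < rk M v.
  have h : 2 < rk M [:: x i; y i b; y j c].
    apply: (@rk_drop1 (x j)); apply: leq_trans (off b c nij nij) (rk_leS _ _).
    by mem_solve.
  by rewrite /v; addt (ty i b); seed h.
apply: (@no_space_cross i j k (~~ b) c d u _ (leq_trans r3 r2)).
have le_v : rk M v <= 3 by apply: leq_trans r2 (rk_size _ _).
apply: leq_trans le_v; rewrite -(rk_add (s := v) (ty i b)) /v; last by mem_solve.
by apply: rk_leS; mem_solve.
Qed.

Lemma no_space_config (i j k : I) : uniq [:: i; j; k] -> False.
Proof.
move=> u; have /and3P[nij nik njk] : [&& i != j, i != k & j != k] by rewrite -uniqE.
have u1 : uniq [:: j; i; k] by rewrite uniqE eq_sym nij njk nik.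
have u4 : uniq [:: k; i; j] by rewrite uniqE !(eq_sym k) nik nij njk.
have [[ti tj] tk] := (ty i true, ty j true, ty k true); have txx := tx u.
pose pts := [:: x i; x j; x k; y i true; y i false; y j true; y j false;
                y k true; y k false].
have plane l : l \in [:: i; j; k] -> rk M [:: x i; x j; x k; y l true; y l false] <= 3.
  move=> lI; apply: leq_trans (_ : rk M [:: y l true; x i; x j; x k] <= 3).
    rewrite -(rk_add (s := [:: y l true; x i; x j; x k]) (ty l true)).
      by apply: rk_leS; mem_solve.
    by move: lI; rewrite !inE => /or3P[] /eqP ->; rewrite !eqxx ?orbT.
  exact: rk_triangle_cons.
apply: (avoidsQ avM).
apply: (@circ_embed 9 4 CQ (QK :: QKs)
  ([:: [:: 0; 1; 3; 5]; [:: 0; 1; 3; 7]; [:: 0; 1; 5; 7]] ++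
   [:: [:: 0; 3; 5; 7]; [:: 0; 3; 5; 8]; [:: 0; 3; 6; 7]; [:: 0; 3; 6; 8];
       [:: 0; 4; 5; 7]; [:: 0; 4; 5; 8]; [:: 0; 4; 6; 7]; [:: 0; 4; 6; 8];
       [:: 1; 5; 3; 7]; [:: 1; 5; 3; 8]; [:: 1; 5; 4; 7]; [:: 1; 5; 4; 8];
       [:: 1; 6; 3; 7]; [:: 1; 6; 3; 8]; [:: 1; 6; 4; 7]; [:: 1; 6; 4; 8];
       [:: 2; 7; 3; 5]; [:: 2; 7; 3; 6]; [:: 2; 7; 4; 5]; [:: 2; 7; 4; 6];
       [:: 2; 8; 3; 5]; [:: 2; 8; 3; 6]; [:: 2; 8; 4; 5]; [:: 2; 8; 4; 6]])
   T M pts checkQ (x i)).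
- by vm_compute.
- exact: rM.
(* Each R_i yields a single 4-element circuit: removing v_i or w_i leaves K, and removing a point of
   K other than u_i leaves K_i, so u_i must go. *)
- have -> : CQ = [:: [:: 0; 1; 2]; [:: 0; 3; 4]; [:: 1; 5; 6]; [:: 2; 7; 8];
       [:: 1; 2; 3; 4]; [:: 0; 2; 5; 6]; [:: 0; 1; 7; 8]] by vm_compute.
  do 4![apply: in_cons_all;
     first by rewrite /= ltnS; first [by case/and4P: txx | by case/and4P: ti
       | by case/and4P: tj | by case/and4P: tk]].
  by do 3![apply: in_cons_all; first by rewrite /= ltnS;
    first [by apply: leq_trans (plane i _); [apply: rk_leS; mem_solve | mem_solve]
     | by apply: leq_trans (plane j _); [apply: rk_leS; mem_solve | mem_solve]
     | by apply: leq_trans (plane k _); [apply: rk_leS; mem_solve | mem_solve]]].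
- by each sym3.
rewrite /=; do 3![apply: in_cons_all; first by rewrite /=; apply: off].
by do 24![apply: in_cons_all; first by rewrite /=; apply: space_generic].
Qed.
End Space.

(** * Connectivity of contractions, and its survival in minors *)

Section Connectivity.
Variables (T : finType) (M : matroid T).
Implicit Types (A B C D S Y Z P : {set T}).
Local Notation r := (rank_of M).

(* [connected_over Z S]: the restriction of M / Z to S is connected. *)
Definition connected_over Z S : bool :=
  [forall Y : {set T}, [&& Y \subset S, Y != set0 & Y != S] ==>
     (r (S :|: Z) + r Z < r (Y :|: Z) + r (S :\: Y :|: Z))].

Lemma connectedP Z S Y : connected_over Z S -> Y \subset S -> Y != set0 -> Y != S ->
  r (S :|: Z) + r Z < r (Y :|: Z) + r (S :\: Y :|: Z).
Proof. by move/forallP/(_ Y)/implyP=> h s1 s2 s3; apply: h; rewrite s1 s2. Qed.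

Lemma connectedPn Z S : ~~ connected_over Z S ->
  exists Y, [/\ Y \subset S, Y != set0, Y != S
    & r (Y :|: Z) + r (S :\: Y :|: Z) <= r (S :|: Z) + r Z].
Proof.
case/forallPn=> Y; rewrite negb_imply -leqNgt => /andP[/and3P[s1 s2 s3] s4].
by exists Y.
Qed.

Lemma connected_card1 Z S : #|S| <= 1 -> connected_over Z S.
Proof.
move=> S1; apply/forallP=> Y; apply/implyP=> /and3P[sY Y0 YS].
have := proper_card (_ : Y \proper S); rewrite properEneq YS sY => /(_ isT).
by rewrite -card_gt0 in Y0; lia.
Qed.

Lemma connected_noloop Z S x : connected_over Z S -> x \in S -> 1 < #|S| ->
  r Z < r (x |: Z).
Proof.
move=> cS xS S1; have := connectedP cS (Y := [set x]).
rewrite sub1set xS => /(_ isT); rewrite -card_gt0 cards1 => /(_ isT).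
have -> : [set x] != S by apply: contraTneq S1 => <-; rewrite cards1.
move=> /(_ isT).
have : r (S :\ x :|: Z) <= r (S :|: Z) by rewrite rankS // setSU // subsetDl.
lia.
Qed.

(** Tutte's theorem: deleting or contracting a point of a connected matroid leaves one of the two
    results connected. If A, B separates the deletion and C, D the contraction, submodularity at the
    pairs A, C and B, D shows that A and C, or B and D, are disjoint. The same with C and D
    exchanged makes one of the four sets empty. *)
Lemma connected_step Z S x : connected_over Z S -> x \in S ->
  connected_over Z (S :\ x) || connected_over (x |: Z) (S :\ x).
Proof.
move=> cS xS; apply: contraT; rewrite negb_or => /andP[].
move=> /connectedPn[A [sA A0 AS rA]] /connectedPn[C [sC C0 CS rC]].
have uncross A' C' : A' \subset S :\ x -> C' \subset S :\ x ->
    r (A' :|: Z) + r (S :\ x :\: A' :|: Z) <= r (S :\ x :|: Z) + r Z ->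
    r (C' :|: (x |: Z)) + r (S :\ x :\: C' :|: (x |: Z)) <=
      r (S :\ x :|: (x |: Z)) + r (x |: Z) ->
    A' :&: C' = set0 \/ (S :\ x :\: A') :&: (S :\ x :\: C') = set0.
  move=> sA' sC' rA' rC'.
  set B := _ :\: A' in rA' *; set D := _ :\: C' in rC' *.
  have sB : B \subset S :\ x by apply: subsetDl.
  have [|n1] := eqVneq (A' :&: C') set0; first by left.
  have [|n2] := eqVneq (B :&: D) set0; first by right.
  have inS Y : Y \subset S :\ x -> Y \subset S /\ Y != S.
    move=> sY; split; first by apply: subset_trans sY (subsetDl _ _).
    by apply: contraTneq sY => ->; apply/subsetPn; exists x; rewrite // !inE eqxx.
  have [s1 e1] := inS (A' :&: C') (subset_trans (subsetIl _ _) sA').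
  have [s2 e2] := inS (B :&: D) (subset_trans (subsetIl _ _) sB).
  have h1 := connectedP cS s1 n1 e1; have h2 := connectedP cS s2 n2 e2.
  have h3 : r (S :\: (B :&: D) :|: Z) + r (A' :&: C' :|: Z) <=
      r (A' :|: Z) + r (C' :|: (x |: Z)).
    apply: rank_sub.
    - by rewrite setSU // subsetIl.
    - by apply: setUSS; rewrite ?subsetIr ?subsetUr.
    apply/subsetP=> z; rewrite !inE; case: (z == x); case: (z \in A');
     by case: (z \in C'); case: (z \in Z); case: (z \in S).
  have h4 : r (S :\: (A' :&: C') :|: Z) + r (B :&: D :|: Z) <=
      r (B :|: Z) + r (D :|: (x |: Z)).
    apply: rank_sub.
    - by rewrite setSU // subsetIl.
    - by apply: setUSS; rewrite ?subsetIr ?subsetUr.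
    apply/subsetP=> z; rewrite !inE; case: (z == x); case: (z \in A');
     by case: (z \in C'); case: (z \in Z); case: (z \in S).
  have h5 : r (S :\ x :|: Z) <= r (S :|: Z) by rewrite rankS // setSU // subsetDl.
  have h6 : S :\ x :|: (x |: Z) = S :|: Z.
    by apply/setP=> z; rewrite !inE; case: eqVneq => [->|]; rewrite ?xS.
  have := rankU1 M x Z; rewrite h6 in rC'.
  by move: rA' rC' h1 h2 h3 h4 h5; clear; lia.
have sub0 (A' : {set T}) : A' \subset S :\ x -> S :\ x :\: (S :\ x :\: A') = A'.
  by move=> sA'; rewrite setDDr setDv set0U (setIidPr sA').
have rC' : r (S :\ x :\: C :|: (x |: Z)) + r (S :\ x :\: (S :\ x :\: C) :|: (x |: Z))
   <= r (S :\ x :|: (x |: Z)) + r (x |: Z) by rewrite sub0 // addnC.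
have h1 := uncross A C sA sC rA rC.
have := uncross A (S :\ x :\: C) sA (subsetDl _ _) rA rC'; rewrite sub0 // => h2.
have part (A' C' : {set T}) : A' \subset S :\ x -> A' :&: C' = set0 ->
    A' :&: (S :\ x :\: C') = set0 -> A' = set0.
  move=> sA' e1 e2; apply/setP=> z; have /setP/(_ z) := e1; have /setP/(_ z) := e2.
  rewrite !inE; case zA: (z \in A') => //=; have := subsetP sA' _ zA.
  by rewrite !inE => ->; case: (z \in C').
have full (A' : {set T}) : A' \subset S :\ x -> S :\ x :\: A' = set0 -> A' = S :\ x.
  by move=> sA' /eqP; rewrite setD_eq0 => sA''; apply/eqP; rewrite eqEsubset sA'.
case: h1 h2 => [e1|e1] [e2|e2].
- by move: A0; rewrite (part A C) ?eqxx.
- move: C0; rewrite (part C A) ?eqxx //; first by rewrite setIC.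
  by rewrite setIC.
- move: CS; rewrite (full C) ?eqxx //.
  apply: (part _ A); rewrite ?subsetDl //; first by rewrite setIC.
  by rewrite setIC.
move: AS; rewrite (full A) ?eqxx //.
by apply: (part _ C); rewrite ?subsetDl.
Qed.

(** Iterates [connected_step] on the points outside P. Every contracted point is independent of
    those before it, which gives the exact rank of [Z']. *)
Lemma connected_reduce Z S P : connected_over Z S -> P \subset S -> P != set0 ->
  (forall y, y \in P -> r Z < r (y |: Z)) ->
  exists Z', [/\ Z \subset Z', Z' \subset Z :|: S, r Z' = r Z + #|Z' :\: Z|,
    connected_over Z' P & forall y, y \in P -> r Z' < r (y |: Z')].
Proof.
have [n] := ubnP #|S :\: P|; elim: n Z S => // n IHn Z S leS cS sP P0 nl.
have [e|[x /setDP[xS xP]]] := set_0Vmem (S :\: P).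
  have -> : P = S by apply/eqP; rewrite eqEsubset sP -setD_eq0 e eqxx.
  exists Z; split=> //; first exact: subsetUl.
    by rewrite setDv cards0 addn0.
  have -> : S = P by apply/eqP; rewrite eqEsubset sP -setD_eq0 e eqxx.
  exact: nl.
have sPx : P \subset S :\ x by rewrite subsetD1 sP.
have leS' : #|S :\ x :\: P| < n.
  by move: leS; rewrite (cardsD1 x (S :\: P)) !inE xS xP setDDl setUC -setDDl; lia.
have [c1|c1] := boolP (connected_over Z (S :\ x)).
  have [Z' [h1 h2 h3 h4 h5]] := IHn _ _ leS' c1 sPx P0 nl.
  by exists Z'; split=> //; apply: subset_trans h2 (setUS _ (subsetDl _ _)).
have := connected_step cS xS; rewrite (negPf c1) /= => c2.
(* A set of at most one point would be connected over Z already. With two or more points,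
   connectedness excludes loops after the contraction. *)
have S2 : 1 < #|S :\ x|.
  by rewrite ltnNge; apply: contra c1; apply: connected_card1.
have nl' y : y \in P -> r (x |: Z) < r (y |: (x |: Z)).
  by move=> yP; apply: (connected_noloop c2 _ S2); apply: (subsetP sPx).
have nx : r Z < r (x |: Z).
  by apply: (connected_noloop cS xS); rewrite (cardsD1 x) xS; lia.
have [Z' [h1 h2 h3 h4 h5]] := IHn _ _ leS' c2 sPx P0 nl'.
have xZ : x \notin Z by apply: contraTN nx => xZ; rewrite -leqNgt (setUidPr _) // sub1set.
have xZ' : x \in Z' by apply: (subsetP h1); rewrite setU11.
exists Z'; split=> //.
- by apply: subset_trans h1; apply: subsetUr.
- apply: subset_trans h2 _; rewrite !subUset sub1set inE xS orbT subsetUl /=.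
  by apply: subset_trans (subsetDl _ _) (subsetUr _ _).
have -> : #|Z' :\: Z| = #|Z' :\: (x |: Z)|.+1.
  rewrite (cardsD1 x (Z' :\: Z)) !inE xZ xZ' add1n; congr _.+1; congr #|pred_of_set _|.
  by rewrite setDDl setUC.
by have := rankU1 M x Z; move: nx h3; clear; lia.
Qed.

End Connectivity.

Ltac mem_cases := rewrite ?inE /=; repeat match goal with
  | |- context[?a == ?b] => case: (a == b) => //=
  | |- context[in_mem ?a ?B] => case: (in_mem a B) => //= end.

(** * From a connected contraction of K to a configuration of rank 3 or 4 *)

Section ConnectedConfig.
Variables (T : finType) (M : matroid T).
Hypothesis avM : avoids M.
Local Notation r := (rank_of M).
Variables (I : finType) (x : I -> T) (y : I -> bool -> T).
Hypothesis x2 : forall i j, i != j -> 1 < rk M [:: x i; x j].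
Hypothesis ty : forall i b, triangle M (x i) (y i b) (y i (~~ b)).
Variables (K S : {set T}).
Hypotheses (rK : r K = 2) (xK : forall i, x i \in K).
Hypothesis offK : forall i b, r K < r (y i b |: K).
Hypothesis sS : S \subset ground M.
Hypotheses (yS : forall i, y i true \in S) (cS : connected_over M K S).

(** Reducing to the points [y l true] is enough, since over K each is parallel to its [y l false].
    Over the contracted set Z they are all parallel, and the minor is a grid of rank 3, or any two
    of them span the third, and it is the space configuration of rank 4. *)
Lemma no_connected_config (i j k : I) : (forall l, l \in [:: i; j; k]) ->
  uniq [:: i; j; k] -> False.
Proof.
move=> enumI u.
have ty_cl l b (Z : {set T}) : K \subset Z -> r (y l true |: (y l b |: Z)) = r (y l b |: Z).
  move=> sKZ; apply: (@rank_cl _ _ _ [set x l; y l b]).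
    rewrite subUset !sub1set !inE eqxx (subsetP sKZ) ?xK ?orbT //.
  have /and4P[t1 t2 t3 t4] := ty l b.
  have -> : r [set x l; y l b] = rk M [:: x l; y l b].
    by congr rank_of; apply/setP=> z; rewrite !inE.
  apply: leq_trans (_ : rk M [:: x l; y l b; y l true] <= _).
    by apply: rankS; apply/subsetP=> z; mem_cases.
  case: (b) t1 t2 => t1 t2; last exact: leq_trans t1 t2.
  by apply: rk_leS; mem_solve.
pose P := [set y l true | l : I].
have sP : P \subset S by apply/subsetP=> _ /imsetP[l _ ->].
have P0 : P != set0 by apply/set0Pn; exists (y i true); apply/imsetP; exists i.
have nlP z : z \in P -> r K < r (z |: K) by case/imsetP=> l _ ->.
have [Z [sKZ sZ rZ cP nlZ]] := connected_reduce cS sP P0 nlP.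
have nlZ' l b : r Z < r (y l b |: Z).
  apply: leq_trans (nlZ (y l true) _) _; first by apply/imsetP; exists l.
  by rewrite -(ty_cl l b Z sKZ) rankS // setUS // subsetUr.
(* Contracting W instead of Z keeps the points [x l] as a line of rank 2, because W adds its full
   size to the rank of K. *)
pose W := Z :\: K.
have ZE : W :|: K = Z.
  apply/setP=> z; rewrite !inE; case zK: (z \in K); rewrite /= ?orbF //.
  by rewrite (subsetP sKZ).
have rW : r W = #|W|.
  apply/eqP; rewrite eqn_leq rank_le_card /=.
  by have := rankU M W K; rewrite ZE rZ rK -/W; clear; lia.
have rZW : r Z = #|W| + 2 by rewrite rZ rK addnC.
have sW : W \subset ground M.
  apply/subsetP=> z /setDP[zZ zK]; have := subsetP sZ z zZ; rewrite inE (negPf zK).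
  exact: subsetP.
pose A := [set x l | l : I] :|: ([set y l true | l : I] :|: [set y l false | l : I]).
have xA l : x l \in A by rewrite !inE imset_f.
have yA l b : y l b \in A by case: b; rewrite !inE imset_f ?orbT.
have mA z : z \in A -> (exists l, z = x l) \/ (exists l b, z = y l b).
  rewrite !inE => /or3P[]/imsetP[l _ ->]; first by left; exists l.
    by right; exists l, true.
  by right; exists l, false.
have rkx l : 0 < rk M [:: x l].
  have := rk_cons M (y l true) [:: x l]; rewrite rk2C.
  by have /and4P[_ h _ _] := ty l true; move: h; clear; lia.
have sA : A \subset ground M.
  apply/subsetP=> z /mA[[l ->]|[l [b ->]]].
    apply: (@rk1_ground _ _ _ [::]); apply: leq_ltn_trans (rkx l); exact: rk_size.
  exact: (ground_of_rank (offK l b)).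
have dAW : [disjoint A & W].
  apply/pred0P=> z /=; apply/negP=> /andP[/mA[[l ->]|[l [b ->]]]]; rewrite inE.
    by rewrite xK.
  case/andP=> _ yZ; have := nlZ' l b; rewrite (setUidPr _) ?sub1set //.
  by rewrite ltnn.
have [N [mN gN rN]] := minor_exists sA sW dAW.
have avN := avoids_minor mN avM.
have rNs s : all [in A] s -> rk N s = r ([set z in s] :|: W) - #|W|.
  move=> /allP sAs; rewrite /rk rN ?rW //.
  by apply/subsetP=> z; rewrite inE => /sAs.
have rkK l m : l != m -> forall z, z \in K -> r (z |: [set x l; x m]) <= r [set x l; x m].
  move=> nlm z zK; have -> : r [set x l; x m] = rk M [:: x l; x m].
    by congr rank_of; apply/setP=> t; rewrite !inE.
  apply: leq_trans (x2 nlm); rewrite -rK; apply: rankS.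
  by rewrite !subUset !sub1set zK !xK.
(* Two of the points [x] span K, so over W they account for exactly the rank 2 by which Z exceeds W;
   the remaining points are measured over Z. *)
have rxx l m s : l != m -> all [in A] s ->
    rk N [:: x l, x m & s] = r ([set z in s] :|: Z) + 2 - r Z.
  move=> nlm sAs; rewrite rNs /= ?xA //.
  have -> : r ([set z in [:: x l, x m & s]] :|: W) = r ([set z in s] :|: Z).
    rewrite -(@rank_clU _ _ [set x l; x m] _ K) ?rkK //; last exact: rkK.
      apply/eqP; rewrite eqn_leq !rankS //.
        by rewrite -ZE; apply/subsetP=> z; mem_cases.
      rewrite -ZE; apply/subsetP=> z; rewrite !inE.
      by have [->|_] := eqVneq z (x l); [by rewrite xK !orbT|];
         have [->|_] := eqVneq z (x m); [by rewrite xK !orbT|]; mem_cases.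
    by rewrite subUset !sub1set !inE !eqxx !orbT.
  by rewrite rZW subnDr.
have uniqE (l m p : I) : uniq [:: l; m; p] = [&& l != m, l != p & m != p].
  by rewrite /= !inE negb_or andbT -andbA.
have cl0 : r ([set z in [::]] :|: Z) = r Z.
  by congr rank_of; apply/setP=> z; rewrite !inE.
have xxN l m : l != m -> 1 < rk N [:: x l; x m].
  by move=> nlm; rewrite (rxx l m [::]) // cl0; clear; lia.
have offN l m p b : l != m -> 2 < rk N [:: x l; x m; y p b].
  move=> nlm; rewrite rxx //= ?yA //.
  have -> : [set z in [:: y p b]] = [set y p b] by apply/setP=> z; rewrite !inE.
  by have := nlZ' p b; clear; lia.
have txN l m p : uniq [:: l; m; p] -> triangle N (x l) (x m) (x p).
  rewrite uniqE => /and3P[n1 n2 n3]; apply/and4P; split; try exact: xxN.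
  rewrite rxx //= ?xA //.
  have -> : [set z in [:: x p]] :|: Z = Z.
    by apply/setUidPr/subsetP=> z; rewrite !inE => /eqP->; apply: (subsetP sKZ).
  by clear; lia.
have other (l : I) : exists m, l != m.
  move: u; rewrite uniqE => /and3P[n1 n2 n3].
  by have [->|] := eqVneq l i; [exists j | exists i].
have xyN l b : 1 < rk N [:: x l; y l b].
  have [m nlm] := other l; rewrite eq_sym in nlm.
  by have := offN _ _ l b nlm; have := rk_cons N (x m) [:: x l; y l b]; clear; lia.
have tyN l b : triangle N (x l) (y l b) (y l (~~ b)).
  have /and4P[t1 t2 t3 t4] := ty l b.
  apply/and4P; split; rewrite ?xyN //.
    rewrite rNs /= ?xA ?yA // leq_subLR -rW.
    by apply: leq_trans (rankU _ _ _) _; rewrite addnC leq_add2l.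
  apply: leq_trans (xyN l b) _; rewrite !rNs /= ?xA ?yA // leq_sub2r //.
  apply: leq_trans (_ : r (x l |: ([set z in [:: y l b; y l (~~ b)]] :|: W)) <= _).
    by apply: rankS; apply/subsetP=> z; mem_cases.
  rewrite (@rank_cl _ _ _ [set z in [:: y l b; y l (~~ b)]]) ?subsetUl //.
  by rewrite -set_seq_cons; apply: leq_trans t1 t4.
have rankN : rank N <= r (P :|: Z) + 2 - r Z.
  rewrite /rank gN rN // rW rZW subnDr leq_sub2r //.
  apply: leq_trans (_ : r (A :|: (P :|: Z)) <= _).
    by rewrite rankS // setUS //; apply/subsetP=> z zW; rewrite in_setU -ZE in_setU zW orbT.
  have clA z : z \in A -> r (z |: (P :|: Z)) <= r (P :|: Z).
    case/mA=> [[l ->]|[l [b ->]]].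
      rewrite (setUidPr _) // sub1set inE (subsetP sKZ) ?orbT //.
    have yP : y l true \in P by apply: imset_f.
    have /and4P[t1 t2 t3 t4] := ty l b.
    rewrite (@rank_cl _ _ _ [set x l; y l true]) //.
      by rewrite subUset !sub1set !inE yP (subsetP sKZ) ?orbT.
    have -> : r [set x l; y l true] = rk M [:: x l; y l true].
      by congr rank_of; apply/setP=> z'; rewrite !inE.
    apply: leq_trans (_ : rk M [:: x l; y l b; y l true] <= _).
      by apply: rankS; apply/subsetP=> z'; mem_cases.
    case: (b) t1 t3 => t1 t3; last exact: leq_trans t1 t3.
    by apply: rk_leS; mem_solve.
  by rewrite (@rank_clU _ _ (P :|: Z)).
have [small|big] := leqP (r (P :|: Z)) (r Z).+1.
  have r3 : rank N <= 3 by move: rankN small; clear; lia.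
  exact: (@no_grid _ _ avN r3 I x y txN tyN offN i j k u).
have third (l m : I) : l != m -> exists q, forall p, p \in [:: l; m; q].
  have [el em] := (enumI l, enumI m); move: el em; rewrite !inE.
  case/or3P=> /eqP-> /or3P[]/eqP->; rewrite ?eqxx // => _;
    [exists k | exists j | exists k | exists i | exists j | exists i] => p;
    by have := enumI p; rewrite !inE => /or3P[]->; rewrite ?orbT.
(* Connectedness makes the third point of P redundant: it adds at most 1 to the rank of Z, so the
   strict inequality leaves the full rank of P to the other two. *)
have pair l m : l != m -> r (P :|: Z) <= r (y l true |: (y m true |: Z)).
  move=> nlm; have [q allq] := third l m nlm; pose z := y q true.
  have zP : z \in P by apply: imset_f.
  have sPlm : P :\ z \subset [set y l true; y m true].
    apply/subsetP=> t /setD1P[zq /imsetP[p _ pE]]; rewrite pE in zq *.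
    have := allq p; rewrite !inE => /or3P[]/eqP e; move: zq; rewrite e ?eqxx ?orbT //.
  have sU : P :\ z :|: Z \subset y l true |: (y m true |: Z).
    by rewrite setUA setSU.
  have [PE|nP] := eqVneq [set z] P.
    apply: rankS; rewrite setUA setSU // -PE sub1set.
    have : y l true \in P by apply: imset_f.
    by rewrite -PE !inE => /eqP->; rewrite eqxx.
  have := connectedP cP (Y := [set z]); rewrite sub1set => /(_ zP).
  rewrite -card_gt0 cards1 => /(_ isT nP).
  have := rankS M sU; have := rankU1 M z Z; clear; lia.
have nij : i != j by move: u; rewrite uniqE => /and3P[].
have PE : r (P :|: Z) <= (r Z).+2.
  have := pair i j nij; have := rankU1 M (y j true) Z.
  by have := rankU1 M (y i true) (y j true |: Z); clear; lia.
have off4 l m l' m' b c : l != m -> l' != m' ->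
    3 < rk N [:: x l'; x m'; y l b; y m c].
  move=> n1 n2; rewrite rxx //= ?yA //.
  have -> : [set z in [:: y l b; y m c]] :|: Z = y l b |: (y m c |: Z).
    by apply/setP=> z; rewrite !inE -!orbA.
  have : r (y l true |: (y m true |: Z)) <= r (y l b |: (y m c |: Z)).
    have sK2 z : K \subset z |: Z by apply: subset_trans sKZ (subsetUr _ _).
    rewrite -(ty_cl l b) //.
    apply: leq_trans (_ : r (y l true |: (y l b |: (y m true |: (y m c |: Z)))) <= _).
      by apply: rankS; apply/subsetP=> z; mem_cases.
    rewrite [y l b |: (y m true |: _)]setUCA setUCA.
    rewrite (@rank_cl _ _ _ (y m c |: Z)) ?ty_cl //.
    by apply/subsetP=> z; rewrite !inE => ->; rewrite !orbT.
  by have := pair l m n1; move: big; clear; lia.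
have r4 : rank N <= 4 by move: rankN PE; clear; lia.
exact: (@no_space_config _ _ avN r4 I x y txN tyN off4 i j k u).
Qed.
End ConnectedConfig.

(** * Long lines and their separations *)

Definition long_line (T : finType) (M : matroid T) (L : {set T}) : bool :=
  [&& L \subset ground M, rank_of M L == 2, 2 < #|L|
    & [forall x in ground M, (rank_of M (x |: L) <= 2) ==> (x \in L)]].

Section LongLines.
Variables (T : finType) (M : matroid T).
Hypothesis sM : simple M.
Implicit Types (A B K L : {set T}).
Local Notation r := (rank_of M).

Lemma long_line_sub L : long_line M L -> L \subset ground M.
Proof. by case/and4P. Qed.

Lemma long_line_ground L x : long_line M L -> x \in L -> x \in ground M.
Proof. by move/long_line_sub/subsetP; apply. Qed.

Lemma long_line_rank L : long_line M L -> r L = 2.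
Proof. by case/and4P=> _ /eqP. Qed.

Lemma long_line_card L : long_line M L -> 2 < #|L|.
Proof. by case/and4P. Qed.

Lemma long_line_closed L x : long_line M L -> x \in ground M -> x \notin L ->
  2 < r (x |: L).
Proof.
case/and4P=> _ _ _ /forall_inP cl xM xL; rewrite ltnNge.
by apply: contra xL; apply/implyP/cl.
Qed.

Lemma rank_pair L x y : long_line M L -> x \in L -> y \in L -> x != y ->
  r [set x; y] = 2.
Proof. by move=> lL xL yL; apply: simple_rank2 => //; apply: long_line_ground lL _. Qed.

Lemma long_line_span L A x y z : long_line M L -> x \in L -> y \in L -> z \in L ->
  x != y -> x \in A -> y \in A -> r (z |: A) = r A.
Proof.
move=> lL xL yL zL nxy xA yA; apply: (@rank_cl _ _ _ [set x; y]).
  by rewrite subUset !sub1set xA.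
rewrite (rank_pair lL) // -(long_line_rank lL); apply: rankS.
by rewrite !subUset !sub1set xL yL zL.
Qed.

Lemma long_line_eq L K x y : long_line M L -> long_line M K -> x != y ->
  x \in L -> y \in L -> x \in K -> y \in K -> L = K.
Proof.
have sub L1 L2 : long_line M L1 -> long_line M L2 -> x != y ->
    x \in L1 -> y \in L1 -> x \in L2 -> y \in L2 -> L1 \subset L2.
  move=> l1 l2 nxy x1 y1 x2 y2; apply/subsetP=> z z1.
  apply: contraT => z2; have := long_line_closed l2 (long_line_ground l1 z1) z2.
  by rewrite (long_line_span (L := L1) (x := x) (y := y)) // (long_line_rank l2).
by move=> lL lK nxy xL yL xK yK; apply/eqP; rewrite eqEsubset !sub.
Qed.

(* The points x and y put z in the closure of A, which meets B in K only. *)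
Lemma separated_line K L A B x y z : long_line M K -> K \subset A -> K \subset B ->
  r A + r B <= r (A :|: B) + 2 -> long_line M L -> x != y ->
  x \in L -> y \in L -> z \in L -> x \in A -> y \in A -> z \in B -> z \in K.
Proof.
move=> lK KA KB sep lL nxy xL yL zL xA yA zB; apply: contraT => zK.
have := long_line_closed lK (long_line_ground lL zL) zK.
have := long_line_span lL xL yL zL nxy xA yA.
have := @rank_sub _ M (z |: A) B (z |: K) (A :|: B).
rewrite setUS // subUset sub1set zB KB => /(_ isT isT).
have -> : A :|: B \subset z |: A :|: B by rewrite setSU // subsetUr.
by move=> /(_ isT); move: sep; clear; lia.
Qed.

End LongLines.

(** * The point on at most one long line *)

Section GoodPoint.
Variables (T : finType) (M : matroid T).
Hypotheses (sM : simple M) (avM : avoids M).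
Local Notation r := (rank_of M).
Local Notation E := (ground M).

Lemma third_point (L : {set T}) x y : 2 < #|L| -> exists2 z, z \in L & (z != x) && (z != y).
Proof.
move=> L3; have : 0 < #|L :\ x :\ y|.
  have := cardsD1 x L; have := cardsD1 y (L :\ x).
  by case: (x \in L); case: (y \in _); move: L3; clear; lia.
by case/card_gt0P=> z; rewrite !inE => /and3P[zy zx zL]; exists z; rewrite ?zx.
Qed.

Theorem good_point : E != set0 ->
  exists2 e, e \in E & forall L1 L2, long_line M L1 -> long_line M L2 ->
    e \in L1 -> e \in L2 -> L1 = L2.
Proof.
move=> E0.
pose good e := [forall L1 : {set T}, forall L2 : {set T},
  [&& long_line M L1, long_line M L2, e \in L1 & e \in L2] ==> (L1 == L2)].
have [/existsP[e /andP[eE /forallP ge]]|/existsPn allbad] :=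
    boolP [exists e, (e \in E) && good e].
  exists e => // L1 L2 l1 l2 e1 e2; have /forallP/(_ L2)/implyP := ge L1.
  by rewrite l1 l2 e1 e2 => /(_ isT)/eqP.
exfalso.
have bad e : e \in E -> exists L1 L2, [/\ long_line M L1, long_line M L2,
    e \in L1, e \in L2 & L1 != L2].
  move=> eE; have := allbad e; rewrite eE => /forallPn[L1 /forallPn[L2]].
  by rewrite negb_imply => /andP[/and4P[l1 l2 e1 e2] n12]; exists L1, L2.
(* The inequality says that the connectivity of X vanishes in M / L, the constant 2 being the rank
   of L: X is a union of components of M / L. *)
pose ok (p : {set T} * {set T}) := [&& long_line M p.1, p.2 \subset E :\: p.1,
  p.2 != set0 & r (p.2 :|: p.1) + r (E :\: p.2) <= r E + 2].
(* The whole of M / L is a starting pair; it is nonempty because a second long line leaves L. *)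
have [p0 ok0] : exists p, ok p.
  have [e eE] := set0Pn _ E0; have [L1 [L2 [l1 l2 e1 e2 n12]]] := bad e eE.
  exists (L1, E :\: L1); rewrite /ok /= l1 subxx setDDr setDv set0U.
  rewrite (setIidPr (long_line_sub l1)) (long_line_rank l1) leq_add2r.
  rewrite rankS ?andbT; last by rewrite subUset subsetDl long_line_sub.
  apply: contra n12 => /eqP d0; have /subsetP s21 : L2 \subset L1.
    by rewrite -setD_eq0 -subset0 -d0 setSD ?long_line_sub.
  have [z zL2 /andP[ze _]] := third_point e e (long_line_card l2).
  by apply/eqP; apply: (long_line_eq sM l1 l2 ze); rewrite ?s21.
case: (arg_minnP (fun p : {set T} * {set T} => #|p.2|) ok0) => -[L X].
move=> /and4P[/= lL sX X0 sepX] minX.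
have sLE := long_line_sub lL.
have dXL z : z \in X -> z \notin L by move/(subsetP sX)/setDP=> [].
have sXE : X \subset E by apply: subset_trans sX (subsetDl _ _).
have XUE : X :|: L :|: (E :\: X) = E.
  apply/setP=> z; rewrite !inE; case zE: (z \in E).
    by case: (z \in X); rewrite ?orbT.
  by rewrite (contraFF (subsetP sXE z) zE) (contraFF (subsetP sLE z) zE) andbF.
have LX : L \subset E :\: X.
  by apply/subsetP=> z zL; rewrite inE (subsetP sLE) // andbT; apply: contraL zL; apply: dXL.
(* A point u of K outside X and L, the point x, and a third point of K: two of these lie on one side
   of the separation and pull the remaining one into L. *)
have lineX K x : long_line M K -> x \in X -> x \in K -> K \subset X :|: L.
  move=> lK xX xK; apply/subsetP=> u uK; apply: contraT; rewrite inE negb_or => /andP[uX uL].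
  have uB : u \in E :\: X by rewrite inE uX (long_line_ground lK).
  have nux : u != x by apply: contraNneq uX => ->.
  have [v vK /andP[vu vx]] := third_point u x (long_line_card lK).
  have [vX|vX] := boolP (v \in X).
    suff: u \in L by rewrite (negPf uL).
    apply: (@separated_line _ M sM L K (X :|: L) (E :\: X) x v u) => //;
      rewrite ?subsetUr ?XUE //.
    - by rewrite eq_sym.
    - by rewrite inE xX.
    by rewrite inE vX.
  suff: x \in L by rewrite (negPf (dXL _ xX)).
  apply: (@separated_line _ M sM L K (E :\: X) (X :|: L) u v x) => //; rewrite ?subsetUr //.
  - by rewrite addnC (setUC (E :\: X)) XUE.
  - by rewrite eq_sym.
  - by rewrite inE vX (long_line_ground lK).
  by rewrite inE xX.
have [x0 x0X] := set0Pn _ X0.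
have [K [_ [lK _ x0K _ _]]] := bad x0 (subsetP sXE _ x0X).
pose G := X :|: L; have sKG : K \subset G := lineX K x0 lK x0X x0K.
have nKL : K != L by apply: contraTneq x0K => ->; apply: dXL.
have conK : connected_over M K (G :\: K).
  apply: contraT => /connectedPn[Y0 [sY0 Y00 Y0G]].
  have GE : G :\: K :|: K = G.
    by apply/setP=> z; rewrite !inE; have := subsetP sKG z; rewrite !inE;
       case: (z \in K) => //= [->|]; rewrite ?orbT ?orbF.
  rewrite GE (long_line_rank lK) => sepY0.
  (* Either part of a separation meets L. The two points so found and a third point of L then
     contradict [separated_line] for K. *)
  suff cut (Y : {set T}) : Y \subset G :\: K -> Y != set0 ->
      r (Y :|: K) + r (G :\: K :\: Y :|: K) <= r G + 2 -> exists2 l, l \in L & l \in Y.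
    have [l1 l1L l1Y] := cut Y0 sY0 Y00 sepY0.
    have [|||l2 l2L l2Y] := cut (G :\: K :\: Y0); rewrite ?subsetDl //.
    - by apply: contra Y0G; rewrite setD_eq0 eqEsubset sY0.
    - by rewrite setDDr setDv set0U (setIidPr sY0) addnC.
    set A := Y0 :|: K in sepY0; set B := _ :|: K in sepY0.
    have AB : A :|: B = G.
      rewrite -GE; apply/setP=> z; have := subsetP sY0 z; rewrite !inE.
      case: (z \in Y0) => [/(_ isT)/andP[/negPf-> ->]|_] //.
      by case: (z \in K).
    have l1A : l1 \in A by rewrite inE l1Y.
    have l2B : l2 \in B by rewrite inE l2Y.
    have l1K : l1 \notin K by have := subsetP sY0 _ l1Y; rewrite inE => /andP[].
    have l2K : l2 \notin K by move: l2Y; rewrite !inE => /and3P[].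
    have [l3 l3L /andP[n31 n32]] := third_point l1 l2 (long_line_card lL).
    have : l3 \in A :|: B by rewrite AB inE l3L orbT.
    rewrite inE => /orP[l3A|l3B].
      have : l2 \in K.
        apply: (@separated_line _ M sM K L A B l3 l1 l2) => //; rewrite ?subsetUr ?AB //.
      by rewrite (negPf l2K).
    have : l1 \in K.
      apply: (@separated_line _ M sM K L B A l3 l2 l1) => //; rewrite ?subsetUr //.
      by rewrite addnC (setUC B) AB.
    by rewrite (negPf l1K).
  move=> sY Yn0 sepY.
  have [/existsP[l /andP[lL' lY]]|/existsPn noL] := boolP [exists l, (l \in L) && (l \in Y)].
    by exists l.
  have notL z : z \in L -> z \notin Y by move=> zL; have := noL z; rewrite zL.
  have YX : Y \subset X.
    apply/subsetP=> z zY; have := subsetP sY _ zY; rewrite !inE => /andP[_ /orP[//|zL]].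
    by have := notL z zL; rewrite zY.
  set Y' := G :\: K :\: Y in sepY.
  have okY : ok (K, Y).
    rewrite /ok /= lK Yn0 /=; apply/andP; split.
      apply/subsetP=> z zY; have := subsetP sY _ zY; rewrite !inE => /andP[-> _].
      by rewrite (subsetP sXE) // (subsetP YX).
    (* Uncrossing the two separations along L, which misses Y, shows that Y is separated in M / K
       from everything, not only inside G. It lacks [x0], hence is smaller than X. *)
    have : r (E :\: Y) + r L <= r (Y' :|: K) + r (E :\: X).
      apply: rank_sub => //.
        apply/subsetP=> z zL; rewrite !inE zL (notL z zL) orbT.
        by case: (z \in K).
      apply/subsetP=> z; rewrite !inE.
      by case: (z \in Y); case: (z \in K); case: (z \in X); case: (z \in E);
         rewrite ?orbT.
    rewrite (long_line_rank lL); move: sepX sepY; rewrite -/G; clear; lia.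
  have := minX _ okY; rewrite /= leqNgt => /negP[]; apply: proper_card.
  rewrite properE YX; apply/subsetPn; exists x0 => //.
  by apply: contraL x0K => /(subsetP sY); rewrite inE => /andP[].
(* For z in X two long lines are available and both stay in G; for z in L the line L itself differs
   from K. *)
have other z : z \in K -> exists J, [/\ long_line M J, z \in J, J \subset G & J != K].
  move=> zK; have := subsetP sKG z zK; rewrite inE => /orP[zX|zL].
    have [J1 [J2 [l1 l2 z1 z2 n12]]] := bad z (subsetP sXE _ zX).
    have [e1|n1] := eqVneq J1 K; last by exists J1; split=> //; apply: lineX zX z1.
    by exists J2; split=> //; [apply: lineX zX z2 | rewrite -e1 eq_sym].
  by exists L; split=> //; [apply: subsetUr | rewrite eq_sym].
have branch z : z \in K -> exists p : T * T, [/\ p.1 \in G :\: K, p.2 \in G :\: K,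
    p.1 != p.2 & exists2 J, long_line M J & [/\ z \in J, p.1 \in J & p.2 \in J]].
  move=> zK; have [J [lJ zJ sJ nJK]] := other z zK.
  have [p1 p1J /andP[n1 _]] := third_point z z (long_line_card lJ).
  have [p2 p2J /andP[n2 n21]] := third_point z p1 (long_line_card lJ).
  have off p : p \in J -> p != z -> p \in G :\: K.
    move=> pJ npz; rewrite inE (subsetP sJ) // andbT; apply: contra nJK => pK.
    by apply/eqP; apply: (long_line_eq sM lJ lK npz).
  by exists (p1, p2); split=> //=; rewrite ?off // 1?eq_sym //; exists J.
have [xs [uxs sxs szxs]] : exists xs : seq T, [/\ uniq xs, {subset xs <= K} & size xs = 3].
  exists (take 3 (enum K)); split; first by rewrite take_uniq ?enum_uniq.
    by move=> z /mem_take; rewrite mem_enum.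
  by rewrite size_takel // -cardE (long_line_card lK).
pose x (i : 'I_3) := nth x0 xs i.
have xK i : x i \in K by apply: sxs; rewrite mem_nth ?szxs.
have xinj i j : i != j -> x i != x j by move=> nij; rewrite nth_uniq ?szxs.
have [ys ysP] := fin_all_exists (fun i => branch (x i) (xK i)).
pose y i (b : bool) := if b then (ys i).1 else (ys i).2.
have yG i b : y i b \in G :\: K by case: (ysP i) => h1 h2 _ _; case: b.
have sGE : G \subset E by rewrite subUset sXE.
have rk2 a b : a \in E -> b \in E -> a != b -> rk M [:: a; b] = 2.
  move=> aE bE nab; rewrite -(simple_rank2 sM aE bE nab); congr rank_of.
  by apply/setP=> z; rewrite !inE.
have kE z : z \in K -> z \in E by apply: long_line_ground lK.
have yE i b : y i b \in E by have := yG i b; rewrite inE => /andP[_]; apply: subsetP.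
have nxy i b : x i != y i b.
  by apply: contraTneq (xK i) => ->; have := yG i b; rewrite inE => /andP[].
have ty i b : triangle M (x i) (y i b) (y i (~~ b)).
  have nyy : y i b != y i (~~ b) by case: (ysP i) => _ _ n _; case: (b); rewrite // eq_sym.
  apply/and4P; split; rewrite ?rk2 ?yE ?kE //.
  case: (ysP i) => _ _ _ [J lJ [xJ y1 y2]]; rewrite -(long_line_rank lJ).
  by apply: rankS; apply/subsetP=> z; rewrite !inE => /or3P[]/eqP-> //; case: (b).
pose i0 : 'I_3 := inord 0; pose i1 : 'I_3 := inord 1; pose i2 : 'I_3 := inord 2.
apply: (@no_connected_config _ M avM _ x y _ ty K (G :\: K) _ xK _ _ _ conK i0 i1 i2).
- by move=> i j nij; rewrite rk2 ?kE ?xinj.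
- exact: long_line_rank.
- move=> i b; rewrite (long_line_rank lK); apply: long_line_closed => //.
  by have := yG i b; rewrite inE => /andP[].
- by apply: subset_trans sGE; apply: subsetDl.
- by move=> i; apply: yG.
- by case=> [[|[|[|//]]] h]; rewrite !inE -!val_eqE /= !inordK.
by rewrite /= !inE -!val_eqE /= !inordK.
Qed.

End GoodPoint.

(** * Flats, closures and independence *)

Section Flats.
Variables (T : finType) (M : matroid T).
Implicit Types A F X : {set T}.
Local Notation r := (rank_of M).
Local Notation E := (ground M).

Definition mclosure (A : {set T}) := [set z in E | r (z |: A) <= r A].

Lemma flat_closure A : flat M (mclosure A).
Proof.
split=> [|e]; first by apply/subsetP=> z; rewrite inE => /andP[].
rewrite !inE => /andP[]; rewrite negb_and -ltnNge => /orP[/negP h1 /h1 //|h eE].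
have cl x : x \in mclosure A -> r (x |: A) <= r A by rewrite inE => /andP[].
have e1 := rank_clU (subxx A) cl; have e2 := rank_clU (subsetUr [set e] A) cl.
have := rankS M (subsetUl (mclosure A) A); rewrite e1 => le1.
apply: leq_ltn_trans le1 (leq_trans h _); rewrite -e2.
apply: leq_trans (_ : r ((e |: mclosure A) :|: (A :&: E)) <= _).
  rewrite -[in X in X <= _]rank_groundI; apply: rankS; apply/subsetP=> z; rewrite !inE.
  by case/andP=> /or3P[h1|h2|h3] h4; rewrite ?h1 ?h2 ?h3 ?h4 ?orbT.
rewrite (setUidPl _) //; apply/subsetP=> z; rewrite !inE => /andP[zA zE].
by rewrite zE (setUidPr _) ?leqnn ?orbT // sub1set.
Qed.

Lemma flat_ground : flat M E.
Proof. by split=> // e; rewrite setDv inE. Qed.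

Lemma flat_rankS F A x : flat M F -> A \subset F -> x \in E -> x \notin F ->
  r A < r (x |: A).
Proof.
case=> _ flF sAF xE xF; rewrite ltnNge; apply/negP=> h.
have := flF x; rewrite inE xF xE => /(_ isT).
by rewrite (rank_cl sAF h) ltnn.
Qed.

(** The bridge from [parallel_connection], which only speaks of flats, to independence: the closure
    of the remaining points is the separating flat. *)
Lemma indep_flats X : X \subset E ->
  (indep M X <-> forall x, x \in X -> exists F, [/\ flat M F, X :\ x \subset F & x \notin F]).
Proof.
move=> sX; split=> [iX x xX|sep].
  exists (mclosure (X :\ x)); split; first exact: flat_closure.
    apply/subsetP=> z zX; rewrite inE (setUidPr _) ?sub1set // leqnn andbT.
    by apply: (subsetP sX); case/setD1P: zX.
  rewrite inE (subsetP sX) //= -ltnNge setD1K //.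
  have iX' : indep M (X :\ x) by apply: indep_down iX; apply: subsetDl.
  by move: iX iX'; rewrite !indepE => /eqP-> /eqP->; rewrite (cardsD1 x X) xX.
have [I [iI sIX eI]] := rank_basis M X.
suff -> : X = I by [].
apply/eqP; rewrite eqEsubset sIX andbT; apply/subsetP=> x xX; apply: contraT => xI.
have [F [flF sXF xF]] := sep x xX.
have := flat_rankS flF sXF (subsetP sX _ xX) xF; rewrite setD1K // -eI ltnNge.
by rewrite indep_le_rank // subsetD1 sIX.
Qed.

Definition loopless := forall x, x \in E -> r [set x] = 1.

Lemma flat_set0 : loopless -> flat M set0.
Proof.
move=> nl; split=> [|e]; first exact: sub0set.
by rewrite setD0 setU0 rank_set0 => /nl->.
Qed.

End Flats.

(** * Ranks in a parallel connection, and a criterion for being one *)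

Section ParallelConnection.
Variable T : finType.
Implicit Types (P : matroid T) (A B F X : {set T}).

Lemma parallel_connectionC e (M1 M2 P : matroid T) :
  parallel_connection e M1 M2 P -> parallel_connection e M2 M1 P.
Proof.
case=> h1 h2 h3; split; rewrite 1?setIC 1?setUC // => F sF.
by split=> [/(h3 F sF)[]|[f1 f2]] //; apply/(h3 F sF).
Qed.

Section Facts.
Variables (e : T) (M1 M2 P : matroid T).
Hypothesis pc : parallel_connection e M1 M2 P.
Hypotheses (nl1 : loopless M1) (nl2 : loopless M2).

Let E1 := ground M1.
Let E2 := ground M2.
Let E12 : E1 :&: E2 = [set e]. Proof. by case: pc. Qed.
Let EP : ground P = E1 :|: E2. Proof. by case: pc. Qed.

Lemma pc_common x : x \in E1 -> x \in E2 -> x = e.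
Proof. by move=> x1 x2; apply/set1P; rewrite -E12 inE x1. Qed.

Lemma pc_point : e \in E1 /\ e \in E2.
Proof. by apply/andP; rewrite -in_setI E12 set11. Qed.

Lemma pc_flatU F1 F2 : flat M1 F1 -> flat M2 F2 -> (e \in F1) = (e \in F2) ->
  flat P (F1 :|: F2).
Proof.
move=> fl1 fl2 ee; have [[s1 _] [s2 _]] := (fl1, fl2); have [e1 e2] := pc_point.
have [_ _ /(_ (F1 :|: F2)) ->] := pc; last by rewrite EP setUSS.
have -> : (F1 :|: F2) :&: E1 = F1.
  apply/setP=> z; rewrite !inE; apply/andP/idP => [[/orP[//|z2] z1]|z1]; last first.
    by rewrite z1 (subsetP s1).
  by have ez := pc_common z1 (subsetP s2 _ z2); move: z2; rewrite ez ee.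
have -> // : (F1 :|: F2) :&: E2 = F2.
apply/setP=> z; rewrite !inE; apply/andP/idP => [[/orP[z1|//] z2]|z2]; last first.
  by rewrite z2 orbT (subsetP s2).
by have ez := pc_common (subsetP s1 _ z1) z2; move: z1; rewrite ez ee.
Qed.

(** A flat through [e] is completed by all of the other side; a flat missing [e] is already a flat
    of P, as the empty set is a flat of a loopless matroid. *)
Lemma pc_flat1 F1 : flat M1 F1 ->
  exists F, [/\ flat P F, F :&: E1 = F1 & e \in F1 -> E2 \subset F].
Proof.
move=> fl1; have [s1 _] := fl1; have [e1 e2] := pc_point.
have [eF|eF] := boolP (e \in F1).
  exists (F1 :|: E2); split=> [||_]; last exact: subsetUr.
    by apply: pc_flatU (flat_ground M2) _; rewrite ?eF.
  apply/setP=> z; rewrite !inE; apply/andP/idP => [[/orP[//|z2] z1]|z1].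
    by rewrite (pc_common z1 z2).
  by rewrite z1 (subsetP s1).
exists F1; split=> //; last by apply/setIidPl.
rewrite -[F1]setU0; apply: pc_flatU (flat_set0 nl2) _ => //.
by rewrite inE (negPf eF).
Qed.

Lemma pc_indep1 X : X \subset E1 -> indep P X = indep M1 X.
Proof.
move=> sX; have sXP : X \subset ground P by rewrite EP; apply: subset_trans sX (subsetUl _ _).
apply/idP/idP => [/(indep_flats sXP) sep|/(indep_flats sX) sep].
  apply/(indep_flats sX) => x xX; have [F [flF sF xF]] := sep x xX.
  exists (F :&: E1); split; last by rewrite inE (negPf xF).
    by have [_ _ /(_ F (proj1 flF))[/(_ flF)[]]] := pc.
  by rewrite subsetI sF (subset_trans (subsetDl _ _) sX).
apply/(indep_flats sXP) => x xX; have [F1 [flF sF xF]] := sep x xX.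
have [F [fl eF _]] := pc_flat1 flF; exists F; split=> //.
  by apply: subset_trans sF _; rewrite -eF subsetIl.
by apply: contra xF => xF; rewrite -eF inE xF (subsetP sX).
Qed.

Lemma pc_rank1 X : X \subset E1 -> rank_of P X = rank_of M1 X.
Proof.
move=> sX; apply: eq_bigl => I; case sI: (I \subset X); rewrite ?andbF // !andbT.
by rewrite pc_indep1 // (subset_trans sI).
Qed.

End Facts.

(** One inequality is submodularity at [e]. For the other, bases of both parts through [e] glue to
    an independent set: a point other than [e] is cut off by a flat of its own side completed as in
    [pc_flat1], and [e] by the union of two flats missing it. *)
Lemma pc_rank e (M1 M2 P : matroid T) : parallel_connection e M1 M2 P ->
  loopless M1 -> loopless M2 -> rank P + 1 = rank M1 + rank M2.
Proof.
move=> pc nl1 nl2; have pc' := parallel_connectionC pc.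
have [e1 e2] := pc_point pc.
have [_ EP _] := pc.
have r1 := pc_rank1 pc nl2 (subxx _); have r2 := pc_rank1 pc' nl1 (subxx _).
have re : rank_of P [set e] = 1 by rewrite (pc_rank1 pc) // ?nl1 // sub1set.
apply/eqP; rewrite eqn_leq; apply/andP; split.
  have := @rank_sub _ P (ground M1) (ground M2) [set e] (ground P).
  by rewrite /rank !sub1set e1 e2 EP subxx r1 r2 re => /(_ isT isT isT).
have basis_of (N : matroid T) : e \in ground N -> loopless N ->
    exists B, [/\ indep N B, e \in B, B \subset ground N & #|B| = rank N].
  move=> eN nl; have ie : indep N [set e] by rewrite indepE nl // cards1.
  have [|B [iB sB sBN cB]] := basis_extend ie (X := ground N); first by rewrite sub1set.
  by exists B; rewrite -sub1set.
have [B1 [iB1 eB1 sB1 cB1]] := basis_of M1 e1 nl1.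
have [B2 [iB2 eB2 sB2 cB2]] := basis_of M2 e2 nl2.
have sB : B1 :|: B2 \subset ground P by rewrite EP setUSS.
have side (N1 N2 : matroid T) (C1 C2 : {set T}) : parallel_connection e N1 N2 P ->
    loopless N1 -> loopless N2 -> indep N1 C1 -> e \in C1 -> C1 \subset ground N1 ->
    C2 \subset ground N2 -> forall x, x \in C1 -> x != e ->
    exists F, [/\ flat P F, (C1 :|: C2) :\ x \subset F & x \notin F].
  move=> pcN l1 l2 iC1 eC1 sC1 sC2 x xC xe.
  have [F1 [fl sF xF]] := (indep_flats sC1).1 iC1 x xC.
  have eF : e \in F1 by apply: (subsetP sF); rewrite !inE eC1 eq_sym xe.
  have [F [flF eFE sEF]] := pc_flat1 pcN l2 fl.
  exists F; split=> //.
    apply/subsetP=> z; rewrite !inE => /andP[zx /orP[z1|z2]].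
      have : z \in F1 by apply: (subsetP sF); rewrite !inE zx.
      by rewrite -eFE inE => /andP[].
    by apply: (subsetP (sEF eF)); apply: (subsetP sC2).
  by apply: contra xF => xF; rewrite -eFE inE xF (subsetP sC1).
have iB : indep P (B1 :|: B2).
  apply/(indep_flats sB) => x xB; have [->|xe] := eqVneq x e; last first.
    move: xB; rewrite inE => /orP[xB|xB]; first exact: (side M1 M2).
    by rewrite setUC; apply: (side M2 M1).
  have [F1 [fl1 sF1 eF1]] := (indep_flats sB1).1 iB1 e eB1.
  have [F2 [fl2 sF2 eF2]] := (indep_flats sB2).1 iB2 e eB2.
  exists (F1 :|: F2); split; last by rewrite inE negb_or eF1.
    by apply: (pc_flatU pc); rewrite ?(negPf eF1) ?(negPf eF2).
  by rewrite setDUl setUSS.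
have := indep_le_rank iB sB; have := cardsUI B1 B2.
have -> : B1 :&: B2 = [set e].
  apply/setP=> z; rewrite !inE; apply/andP/eqP => [[z1 z2]|->]; last by rewrite eB1.
  by apply: (pc_common pc); [apply: (subsetP sB1) | apply: (subsetP sB2)].
by rewrite cards1 cB1 cB2 -/(rank P); lia.
Qed.

(** The rank bound makes the two ground sets a modular pair meeting in [p], and modularity passes to
    all subsets through [p] ([rU]). Flats are then tested by adding [p] on both sides. *)
Lemma parallel_connectionI (M M1 M2 : matroid T) p :
  ground M1 :&: ground M2 = [set p] -> ground M = ground M1 :|: ground M2 ->
  rank_of M [set p] = 1 ->
  rank_of M (ground M1) + rank_of M (ground M2) <= rank M + 1 ->
  (forall X, X \subset ground M1 -> rank_of M1 X = rank_of M X) ->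
  (forall X, X \subset ground M2 -> rank_of M2 X = rank_of M X) ->
  parallel_connection p M1 M2 M.
Proof.
move=> E12 EM rp rE r1 r2; split=> // F sF.
have cl_restrict (N : matroid T) (G : {set T}) : ground N \subset ground M ->
    (forall X, X \subset ground N -> rank_of N X = rank_of M X) ->
    flat M G -> flat N (G :&: ground N).
  move=> sN rN flG; split=> [|e]; first exact: subsetIr.
  rewrite !inE negb_and => /andP[/orP[eG|/negP h] eN //].
  rewrite !rN ?subsetIr //; last by rewrite subUset sub1set eN subsetIr.
  exact: flat_rankS flG (subsetIl _ _) (subsetP sN _ eN) eG.
have s1 : ground M1 \subset ground M by rewrite EM subsetUl.
have s2 : ground M2 \subset ground M by rewrite EM subsetUr.
split=> [flF|[fl1 fl2]]; first by split; apply: cl_restrict.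
split=> // e /setDP[eM eF].
wlog e1 : M1 M2 E12 EM rE r1 r2 s1 s2 fl1 fl2 / e \in ground M1 => [hw|].
  move: (eM); rewrite EM inE => /orP[h|h]; first exact: (hw M1 M2).
  by apply: (hw M2 M1) => //; rewrite 1?setIC 1?setUC // addnC.
set r := rank_of M in rp rE r1 r2 *.
pose E1 := ground M1; pose E2 := ground M2.
have p12 : (p \in E1) && (p \in E2) by rewrite -in_setI E12 set11.
have [pE1 pE2] := andP p12.
have cap z : z \in E1 -> z \in E2 -> z = p.
  by move=> z1 z2; apply/set1P; rewrite -E12 inE z1.
have rE' : r (ground M) = r E1 + r E2 - 1.
  have := @rank_sub _ M E1 E2 [set p] (ground M).
  rewrite !sub1set pE1 pE2 EM subxx => /(_ isT isT isT).
  move: rE; rewrite /rank EM -/r -/E1 -/E2 rp; clear; lia.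
have r0 : 0 < r E1 /\ 0 < r E2.
  by rewrite -rp !rankS // sub1set.
have rU A B : A \subset E1 -> B \subset E2 -> p \in A -> p \in B ->
    r (A :|: B) + 1 = r A + r B.
  move=> sA sB pA pB; apply/eqP; rewrite eqn_leq; apply/andP; split.
    have := @rank_sub _ M A B [set p] (A :|: B).
    by rewrite !sub1set pA pB subxx -/r rp => /(_ isT isT isT).
  have h1 : r (ground M) + r A <= r (A :|: E2) + r E1.
    apply: rank_sub; rewrite ?subsetUl // EM.
    by apply/subsetP=> z; rewrite !inE => /orP[]->; rewrite ?orbT.
  have h2 : r (A :|: E2) + r B <= r (A :|: B) + r E2.
    apply: rank_sub; rewrite ?subsetUr //.
    by apply/subsetP=> z; rewrite !inE => /orP[]->; rewrite ?orbT.
  case: r0 h1 h2; rewrite rE'; clear; lia.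
pose F1 := F :&: E1; pose F2 := F :&: E2.
have FE : F = F1 :|: F2 by rewrite -setIUr -EM; apply/esym/setIidPl.
have sF1 : F1 \subset E1 by apply: subsetIr.
have sF2 : F2 \subset E2 by apply: subsetIr.
have eF1 : e \notin F1 by rewrite inE (negPf eF).
have out (G : {set T}) (N : matroid T) z :
    (forall X, X \subset ground N -> rank_of N X = r X) ->
    flat N G -> z \in ground N -> z \notin G -> r G < r (z |: G).
  move=> rN fl zN zG; have [sG _] := fl.
  by rewrite -!rN ?subUset ?sub1set ?zN //; apply: flat_rankS fl (subxx _) _ _.
have re1 : r F1 < r (e |: F1) by apply: (out _ M1).
have [pF|pF] := boolP (p \in F).
  have pF1 : p \in F1 by rewrite inE pF.
  have pF2 : p \in F2 by rewrite inE pF.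
  have := rU F1 F2 sF1 sF2 pF1 pF2.
  have := rU (e |: F1) F2; rewrite subUset sub1set e1 sF1 sF2 !inE pF pE1 pE2 orbT.
  move=> /(_ isT isT isT isT); rewrite -setUA -FE; move: re1; clear; lia.
have pF1 : p \notin F1 by rewrite inE (negPf pF).
have pF2 : p \notin F2 by rewrite inE (negPf pF).
have rp1 : r F1 < r (p |: F1) by apply: (out _ M1).
have rp2 : r F2 < r (p |: F2) by apply: (out _ M2).
have rpF : r F < r (p |: F).
  have := rU (p |: F1) (p |: F2); rewrite !subUset !sub1set pE1 pE2 sF1 sF2 !setU11.
  move=> /(_ isT isT isT isT); rewrite -[p |: F1 :|: _](_ : p |: F = _); last first.
    by rewrite FE; apply/setP=> z; rewrite !inE; case: (z == p);
       case: (z \in F); case: (z \in _); case: (z \in _).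
  by have := rankU M F1 F2; rewrite -FE -/r; move: rp1 rp2; clear; lia.
(* If [p] is in the closure of [e] and F1, then e in the closure of F would put [p] there too,
   against [rpF]. Otherwise [e] and [p] raise F1 by 2, and [rU] gives the count. *)
have [clp|ncl] := leqP (r (p |: (e |: F1))) (r (e |: F1)).
  rewrite ltnNge; apply/negP=> h.
  have : r (p |: (e |: F)) = r (e |: F).
    by apply: rank_cl clp; rewrite setUS // subsetIl.
  have := rankS M (setUS [set p] (subsetUr [set e] F)); rewrite -/r.
  by move: h rpF; clear; lia.
have := rU (p |: (e |: F1)) (p |: F2).
rewrite !subUset !sub1set pE1 pE2 e1 sF1 sF2 !setU11 => /(_ isT isT isT isT).
have -> : p |: (e |: F1) :|: (p |: F2) = p |: (e |: F).
  by rewrite FE; apply/setP=> z; rewrite !inE; case: (z == p); case: (z == e);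
     case: (z \in F); case: (z \in _); case: (z \in _).
have := rankU1 M p (e |: F); have := rankU M F1 F2; rewrite -FE -/r.
by move: re1 rp2 ncl; clear; lia.
Qed.

End ParallelConnection.

(** * Lines as uniform matroids of rank 2 *)

Section Uniform.
Variable T : finType.
Implicit Types (M N : matroid T) (X L : {set T}).

Lemma simple_rank_small M X : simple M -> X \subset ground M -> #|X| <= 2 ->
  rank_of M X = #|X|.
Proof.
move=> sM sX; have inX x : x \in X -> x \in ground M by apply: subsetP.
case e: #|X| => [|[|[|//]]] _.
- by apply/eqP; rewrite -leqn0 -e rank_le_card.
- have /cards1P[x eX] : #|X| == 1 by rewrite e.
  by rewrite eX simple_rank1 // inX // eX set11.
have /cards2P[x [y [nxy eX]]] : #|X| == 2 by rewrite e.
by rewrite eX simple_rank2 ?inX // eX !inE eqxx ?orbT.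
Qed.

Lemma isomorphic_uniform2 N n : simple N -> rank N <= 2 -> #|ground N| = n ->
  0 < n -> isomorphic N (uniform 2 n).
Proof.
move=> sN rN <- /card_gt0P[x0 x0N].
have inj : {in ground N &, injective (enum_rank_in x0N)}.
  by move=> x y xN yN h; rewrite -(enum_rankK_in x0N xN) h enum_rankK_in.
exists (enum_rank_in x0N); split=> //.
  apply/setP=> i; rewrite inE; apply/imsetP; exists (enum_val i); first exact: enum_valP.
  by rewrite enum_valK_in.
move=> X sX; rewrite /= /uniform_indep card_in_imset; last first.
  by move=> x y xX yX; apply: inj; apply: (subsetP sX).
rewrite indepE; apply/idP/eqP => [X2|<-]; first exact: simple_rank_small.
exact: leq_trans (rank_le_ground _ _) rN.
Qed.

Lemma simple_restrict M N : simple M -> ground N \subset ground M ->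
  (forall X, X \subset ground N -> rank_of N X = rank_of M X) -> simple N.
Proof.
move=> sM sN rN; apply: simpleI => [x xN|x y xN yN nxy].
  by rewrite rN ?sub1set // simple_rank1 // (subsetP sN).
by rewrite rN ?subUset ?sub1set ?xN // simple_rank2 // (subsetP sN).
Qed.

Lemma line_card M l L : simple M -> ~ has_minor M (uniform 2 (l + 2)) ->
  L \subset ground M -> rank_of M L <= 2 -> #|L| <= l + 1.
Proof.
move=> sM noU sL rL; rewrite leqNgt; apply/negP=> ltL; apply: noU.
have [L' sL' cL'] : exists2 L' : {set T}, L' \subset L & #|L'| = l + 2.
  exists [set x in take (l + 2) (enum L)].
    by apply/subsetP=> x; rewrite inE => /mem_take; rewrite mem_enum.
  rewrite cardsE (card_uniqP _) ?take_uniq ?enum_uniq //.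
  by rewrite size_takel // -cardE; move: ltL; clear; lia.
have sLM := subset_trans sL' sL.
have [N [mN gN rN]] := restrict_exists sLM.
exists N => //; apply: isomorphic_uniform2; rewrite ?gN ?addn2 //.
- by apply: (simple_restrict sM); rewrite gN.
- by rewrite /rank gN rN // (leq_trans _ rL) // rankS.
by rewrite cL' addn2.
Qed.

Lemma uniform2_facts M n : 2 <= n -> isomorphic M (uniform 2 n) ->
  [/\ loopless M, rank M = 2 & #|ground M| = n].
Proof.
move=> n2 [f [injf imf indf]].
have cE : #|ground M| = n.
  by rewrite -(card_in_imset injf) imf cardsT card_ord.
have ind X : X \subset ground M -> indep M X = (#|X| <= 2).
  move=> sX; rewrite -indf //= /uniform_indep card_in_imset // => x y xX yX.
  by apply: injf; apply: (subsetP sX).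
split=> //.
  move=> x xM; have := ind [set x]; rewrite sub1set xM cards1 indepE cards1.
  by move=> /(_ isT)/eqP.
apply/eqP; rewrite eqn_leq; apply/andP; split.
  by have [I [iI sI cI]] := rank_basis M (ground M); rewrite /rank -cI -ind.
have [X sX cX] : exists2 X : {set T}, X \subset ground M & #|X| = 2.
  exists [set x in take 2 (enum (ground M))].
    by apply/subsetP=> x; rewrite inE => /mem_take; rewrite mem_enum.
  rewrite cardsE (card_uniqP _) ?take_uniq ?enum_uniq //.
  by rewrite size_takel // -cardE cE.
by rewrite -cX; apply: indep_le_rank; rewrite // ind ?cX.
Qed.

End Uniform.

(** * Size, rank and leaf lines of iterated parallel connections *)

Section Closure.
Variables (T : finType) (l : nat).
Hypothesis l_ge1 : 1 <= l.
Implicit Types (M N P : matroid T) (S : {set T}).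

(* A line of l + 1 points that is joined to the rest only at p. *)
Definition leaf_line M S p : Prop :=
  [/\ S \subset ground M, p \in ground M, p \notin S, #|S| = l
    & rank_of M (p |: S) <= 2 /\ rank_of M (ground M :\: S) < rank M].

(** The last clause ranges over all [f] to make the induction work: for [f] in one part, a leaf line
    of the other part that avoids the base point [e] remains a leaf line and avoids [f]. *)
Lemma parallel_closure_facts M : parallel_closure (l + 1) M ->
  [/\ loopless M, 2 <= rank M, #|ground M| = l * (rank M - 1) + 1
    & forall f, f \in ground M -> exists S p, leaf_line M S p /\ f \notin S].
Proof.
elim=> {M} [M iso|e M1 M2 P _ [nl1 r1 c1 leaf1] _ [nl2 r2 c2 leaf2] pc].
  have [|nl rM cM] := uniform2_facts _ iso; first by move: l_ge1; clear; lia.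
  split=> //; rewrite ?rM //; first by rewrite cM; clear; lia.
  move=> f fM; exists (ground M :\ f), f; split; last by rewrite !inE eqxx.
  split; rewrite ?subsetDl ?setD11 //.
    by have := cardsD1 f (ground M); rewrite fM cM; clear; lia.
  rewrite setD1K // -/(rank M) rM; split=> //.
  by rewrite setDDr setDv set0U (setIidPr _) ?sub1set // nl.
have rP := pc_rank pc nl1 nl2; have pc' := parallel_connectionC pc.
have [e1 e2] := pc_point pc; have [E12 EP _] := pc.
have nlP : loopless P.
  move=> x; rewrite EP inE => /orP[x1|x2].
    by rewrite (pc_rank1 pc) ?nl1 // sub1set.
  by rewrite (pc_rank1 pc') ?nl2 // sub1set.
have leaf (N1 N2 : matroid T) : parallel_connection e N1 N2 P -> loopless N1 ->
    loopless N2 -> (forall f, f \in ground N2 -> exists S p, leaf_line N2 S p /\ f \notin S) ->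
    forall f, f \in ground N1 -> exists S p, leaf_line P S p /\ f \notin S.
  move=> pcN l1 l2 lf f f1; have [eN1 eN2] := pc_point pcN.
  have pcN' := parallel_connectionC pcN; have [_ EN _] := pcN.
  have rPN := pc_rank pcN l1 l2.
  have [S [p [[sS pN pS cS [rS rES]] eS]]] := lf e eN2.
  have sN2 : ground N2 \subset ground P by rewrite EN subsetUr.
  exists S, p; split; last first.
    apply: contra eS => fS; suff <- : f = e by [].
    by apply: (pc_common pcN) => //; apply: (subsetP sS).
  split; rewrite ?(subset_trans sS) // ?(subsetP sN2) //.
  split; first by rewrite (pc_rank1 pcN') // subUset sub1set pN.
  have rN1 := pc_rank1 pcN l2 (subxx _).
  have rN2 := pc_rank1 pcN' l1 (subsetDl (ground N2) S).
  have re : rank_of P [set e] = 1 by apply: nlP; rewrite (subsetP sN2).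
  have : rank_of P (ground P :\: S) + rank_of P [set e] <=
      rank_of P (ground N1) + rank_of P (ground N2 :\: S).
    apply: rank_sub; rewrite ?sub1set ?inE ?eS //.
    by apply/subsetP=> z; rewrite EN !inE => /andP[-> ->].
  by rewrite re rN1 rN2; move: rES rPN; rewrite -/(rank N1); clear; lia.
split=> //; first by move: rP r1 r2; clear; lia.
  have := cardsUI (ground M1) (ground M2); rewrite E12 cards1 -EP c1 c2 => cP.
  have [a [b [ea eb]]] : exists a b, rank M1 = a.+1 /\ rank M2 = b.+1.
    by exists (rank M1).-1, (rank M2).-1; move: r1 r2; clear; lia.
  have -> : rank P = (a + b).+1 by move: rP; rewrite ea eb; clear; lia.
  by move: cP; rewrite ea eb !subn1 /= mulnDr; clear; lia.
move=> f; rewrite EP inE => /orP[f1|f2]; first exact: (leaf M1 M2).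
exact: (leaf M2 M1).
Qed.

End Closure.

(** * The bound and the case of equality *)

Section Extremal.
Variables (T : finType) (l : nat).
Hypothesis l_ge1 : 1 <= l.
Implicit Types (M N : matroid T) (A L S X : {set T}).

Definition admissible M : Prop :=
  [/\ simple M, avoids M & ~ has_minor M (uniform 2 (l + 2))].

Lemma admissible_minor M N : minor M N -> simple N -> admissible M -> admissible N.
Proof.
move=> mN sN [_ avM noU]; split=> //; first exact: avoids_minor mN avM.
by move=> h; apply: noU; apply: has_minor_trans mN h.
Qed.

Lemma admissible_restrict M (A : {set T}) : admissible M -> A \subset ground M ->
  exists N, [/\ admissible N, ground N = A
    & forall X, X \subset A -> rank_of N X = rank_of M X].
Proof.
move=> adM sA; have [N [mN gN rN]] := restrict_exists sA.
exists N; split=> //; apply: (admissible_minor mN _ adM).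
by case: adM => sM _ _; apply: (simple_restrict sM); rewrite gN.
Qed.

Lemma admissible_contract M (A : {set T}) e : admissible M -> e \in ground M ->
  A \subset ground M -> e \notin A ->
  (forall x y, x \in A -> y \in A -> x != y -> 2 < rank_of M [set e; x; y]) ->
  exists N, [/\ admissible N, ground N = A
    & forall X, X \subset A -> rank_of N X = rank_of M (e |: X) - 1].
Proof.
move=> adM eM sA eA hA; have [sM _ _] := adM.
have dA : [disjoint A & [set e]] by rewrite disjoint_sym disjoints1.
have se : [set e] \subset ground M by rewrite sub1set.
have [N [mN gN rN]] := minor_exists sA se dA.
have rN' X : X \subset A -> rank_of N X = rank_of M (e |: X) - 1.
  by move=> sX; rewrite rN // setUC simple_rank1.
exists N; split=> //; apply: (admissible_minor mN _ adM).
apply: simpleI => [x|x y]; rewrite gN => xA.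
  rewrite rN' ?sub1set // simple_rank2 // ?(subsetP sA) //.
  by apply: contraNneq eA => ->.
move=> yA nxy; rewrite rN' ?subUset ?sub1set ?xA // setUA.
by have := hA x y xA yA nxy; clear; lia.
Qed.

Lemma rank_closure M A : A \subset ground M -> rank_of M (mclosure M A) = rank_of M A.
Proof.
move=> sA; have cl x : x \in mclosure M A -> rank_of M (x |: A) <= rank_of M A.
  by rewrite inE => /andP[].
rewrite -(rank_clU (subxx A) cl) (setUidPl _) //; apply/subsetP=> z zA.
have e : z |: A = A by apply/setUidPr; rewrite sub1set.
by rewrite inE (subsetP sA) // e leqnn.
Qed.

Lemma closure_long_line M x y z : simple M -> x \in ground M -> y \in ground M ->
  z \in ground M -> x != y -> x != z -> y != z -> rank_of M [set x; y; z] <= 2 ->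
  [/\ long_line M (mclosure M [set x; y]), x \in mclosure M [set x; y]
    & z \in mclosure M [set x; y]].
Proof.
move=> sM xM yM zM nxy nxz nyz r3; have r2 := simple_rank2 sM xM yM nxy.
have ex : x |: [set x; y] = [set x; y] by apply/setUidPr; rewrite sub1set set21.
have ey : y |: [set x; y] = [set x; y] by apply/setUidPr; rewrite sub1set set22.
have xyz : [set x; y; z] \subset mclosure M [set x; y].
  apply/subsetP=> t; rewrite !inE -!orbA => /or3P[]/eqP->.
  - by rewrite xM ex leqnn.
  - by rewrite yM ey leqnn.
  by rewrite zM setUC r2.
have xyM : [set x; y] \subset ground M by rewrite subUset !sub1set xM.
split; try by apply: (subsetP xyz); rewrite !inE eqxx ?orbT.
apply/and4P; split.
- by apply/subsetP=> t; rewrite inE => /andP[].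
- by rewrite rank_closure // r2.
- apply: leq_trans (subset_leq_card xyz).
  by rewrite setUC cardsU1 cards2 nxy !inE negb_or ![z == _]eq_sym nxz nyz.
apply/forall_inP=> t tM; apply/implyP=> rt; rewrite inE tM r2 /=.
apply: leq_trans rt; apply: rankS; apply: setUS.
by apply: subset_trans xyz; apply: subsetUl.
Qed.

(** If no long line passes through [e], a pair of points serves as L, so that both cases are
    contracted in the same way. *)
Lemma exists_good_line M : simple M -> avoids M -> 2 <= rank M ->
  exists e f L, [/\ e \in L, f \in L, f != e, L \subset ground M
   & rank_of M L = 2 /\ forall x y, x \in ground M -> y \in ground M :\: L ->
       x != e -> x != y -> 2 < rank_of M [set e; x; y]].
Proof.
move=> sM avM r2.
have E0 : ground M != set0.
  by apply: contraTneq r2 => E0; rewrite /rank E0 rank_set0.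
have [e eM good] := good_point sM avM E0.
have [f fM nfe] : exists2 f, f \in ground M & f != e.
  have : ~~ (ground M \subset [set e]).
    apply: contraL r2 => /(rankS M); rewrite -ltnNge => h.
    by apply: leq_ltn_trans h _; rewrite simple_rank1.
  by case/subsetPn=> f fM; rewrite inE => nfe; exists f.
have mk x y : x \in ground M -> y \in ground M -> x != e -> y != e -> x != y ->
    rank_of M [set e; x; y] <= 2 ->
    exists2 K, long_line M K & e \in K /\ y \in K.
  move=> xM yM nxe nye nxy h; rewrite eq_sym in nxe; rewrite eq_sym in nye.
  have [lK eK yK] := closure_long_line sM eM xM yM nxe nye nxy h.
  by exists (mclosure M [set e; x]).
have [/existsP[K /andP[lK eK]]|/existsPn noK] := boolP [exists K, long_line M K && (e \in K)].
  have [g gK /andP[nge _]] := third_point e e (long_line_card lK).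
  exists e, g, K; split=> //; first exact: long_line_sub.
  split; first exact: long_line_rank.
  move=> x y xM /setDP[yM yK] nxe nxy; rewrite ltnNge; apply/negP=> h.
  have nye : y != e by apply: contraNneq yK => ->.
  have [J lJ [eJ yJ]] := mk x y xM yM nxe nye nxy h.
  by move: yK; rewrite (good K J) // yJ.
exists e, f, [set e; f]; split; rewrite ?inE ?eqxx ?orbT //.
  by rewrite subUset !sub1set eM.
split; first by rewrite simple_rank2 // eq_sym.
move=> x y xM; rewrite !inE negb_or -andbA => /and3P[nye nyf yM] nxe nxy.
rewrite ltnNge; apply/negP=> h; have [K lK [eK _]] := mk x y xM yM nxe nye nxy h.
by have := noK K; rewrite lK eK.
Qed.

(** N is the simplification of M / e. The points of L other than [e] form the only parallel class
    that can be nontrivial, and [f] represents it. *)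
Lemma good_contraction M : admissible M -> 2 <= rank M ->
  exists e f L N, [/\ admissible N, ground N = f |: (ground M :\: L),
    rank N + 1 = rank M, forall X, X \subset ground N -> rank_of N X = rank_of M (e |: X) - 1
    & [/\ e \in L, f \in L, f != e, L \subset ground M & rank_of M L = 2]
      /\ #|ground N| + #|L| = #|ground M| + 1].
Proof.
move=> adM r2; have [sM avM noU] := adM.
have [e [f [L [eL fL nfe sL [rL good]]]]] := exists_good_line sM avM r2.
pose A := f |: (ground M :\: L).
have [eM fM] := (subsetP sL _ eL, subsetP sL _ fL).
have sA : A \subset ground M by rewrite subUset sub1set fM subsetDl.
have eA : e \notin A by rewrite !inE eL eq_sym (negPf nfe).
have neA x : x \in A -> x != e by apply: contraTneq => ->.
have hA x y : x \in A -> y \in A -> x != y -> 2 < rank_of M [set e; x; y].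
  move=> xA yA nxy; have [xM yM] := (subsetP sA _ xA, subsetP sA _ yA).
  have [yL|yL] := boolP (y \in L); last by apply: good; rewrite ?neA // inE yL.
  have xL : x \notin L.
    apply: contra nxy => xL; move: xA yA; rewrite !inE xL yL !orbF.
    by move=> /eqP-> /eqP->.
  by rewrite setUAC; apply: good; rewrite ?inE ?xL ?neA 1?eq_sym.
have [N [adN gN rN]] := admissible_contract adM eM sA eA hA.
exists e, f, L, N; split; rewrite ?gN //.
  rewrite /rank gN rN //.
  have : rank_of M (ground M) + rank_of M [set e; f] <= rank_of M (e |: A) + rank_of M L.
    apply: rank_sub; rewrite ?subUset ?sub1set ?inE ?eqxx ?orbT //.
      by rewrite eL.
    by apply/subsetP=> z zM; rewrite !inE zM; case: (z \in L); rewrite ?orbT.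
  rewrite simple_rank2 1?eq_sym // rL; have := rankS M (_ : e |: A \subset ground M).
  rewrite subUset sub1set eM sA => /(_ isT).
  have := rankS M (_ : [set e; f] \subset e |: A).
  rewrite simple_rank2 1?eq_sym // subUset !sub1set !inE !eqxx !orbT => /(_ isT).
  clear; lia.
split=> //; rewrite cardsU1 !inE fL /=.
by have := cardsD (ground M) L; rewrite (setIidPr sL); have := subset_leq_card sL; clear; lia.
Qed.

Lemma extremal_bound n M : rank M = n.+1 -> admissible M -> #|ground M| <= l * n + 1.
Proof.
elim: n M => [|n IHn] M rM adM.
  rewrite muln0 add0n; apply/card_le1P => x xM; have [sM _ _] := adM.
  have one y : y \in ground M -> y = x.
    move=> yM; apply/eqP; apply: contraT => nxy.
    have := rank_le_ground M [set y; x].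
    by rewrite rM simple_rank2.
  by move=> y; rewrite !inE; apply/idP/eqP => [/one|->].
have [|e [f [L [N [adN gN rN _ [[eL fL nfe sL rL] cN]]]]]] := good_contraction adM.
  by rewrite rM.
have := IHn N; rewrite rM in rN; move=> /(_ _ adN) IH.
have {}IH : #|ground N| <= l * n + 1 by apply: IH; move: rN; clear; lia.
have [sM _ noU] := adM.
have : #|L| <= l + 1 by apply: (line_card sM noU); rewrite ?rL.
by rewrite mulnS; move: IH cN; clear; lia.
Qed.

Lemma simple_triangle M a b c : simple M -> a \in ground M -> b \in ground M ->
  c \in ground M -> a != b -> a != c -> b != c -> rank_of M [set a; b; c] <= 2 ->
  triangle M a b c.
Proof.
move=> sM aM bM cM nab nac nbc h.
have pair u v : u \in ground M -> v \in ground M -> u != v -> 1 < rk M [:: u; v].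
  move=> uM vM nuv; rewrite -(simple_rank2 sM uM vM nuv); apply: rankS.
  by apply/subsetP=> z; rewrite !inE.
apply/and4P; split; rewrite ?pair //; apply: leq_trans h; apply: rankS.
by apply/subsetP=> z; rewrite !inE orbA.
Qed.

(* Three non-collinear points of S and the points where the lines joining them
   leave S would form an M(K_4). *)
Lemma leaf_collinear M S s1 s2 : admissible M -> S \subset ground M ->
  (forall s, s \in S -> rank_of M (ground M :\: S) < rank_of M (s |: (ground M :\: S))) ->
  (forall s s', s \in S -> s' \in S -> s != s' ->
     exists2 h, h \in ground M :\: S & rank_of M [set s; s'; h] <= 2) ->
  s1 \in S -> s2 \in S -> s1 != s2 ->
  exists2 p, p \in ground M :\: S & rank_of M (p |: S) <= 2.
Proof.
move=> adM sS off meet s1S s2S n12; have [sM avM _] := adM.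
have SM s : s \in S -> s \in ground M by apply: subsetP.
have HM h : h \in ground M :\: S -> h \in ground M by case/setDP.
have nsh s h : s \in S -> h \in ground M :\: S -> s != h.
  by move=> sS' /setDP[_ hS]; apply: contraNneq hS => <-.
have [h12 H12 c12] := meet s1 s2 s1S s2S n12.
have r12 := simple_rank2 sM (SM _ s1S) (SM _ s2S) n12.
exists h12 => //.
suff col s3 : s3 \in S -> rank_of M (s3 |: [set s1; s2]) <= 2.
  have clS x : x \in h12 |: S -> rank_of M (x |: [set s1; s2]) <= rank_of M [set s1; s2].
    by rewrite r12 !inE => /orP[/eqP->|/col //]; rewrite setUC.
  by rewrite -r12 -(rank_clU (subxx [set s1; s2]) clS) rankS // subsetUl.
move=> s3S; rewrite leqNgt; apply/negP=> i123.
have n3 s : s \in [set s1; s2] -> s3 != s.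
  by move=> sE; apply: contraTneq i123 => ->; rewrite (setUidPr _) ?sub1set // r12.
have n13 : s1 != s3 by rewrite eq_sym n3 ?inE ?eqxx.
have n23 : s2 != s3 by rewrite eq_sym n3 ?inE ?eqxx ?orbT.
have [h13 H13 c13] := meet s1 s3 s1S s3S n13.
have [h23 H23 c23] := meet s2 s3 s2S s3S n23.
have e3 : s3 |: [set s1; s2] = [set s1; s2; s3] by rewrite setUC.
(* Two joining lines that left S at the same point [h] would coincide; so the three exit points are
   distinct. *)
have diff a b c h : a \in S -> h \in ground M :\: S -> rank_of M [set a; b; h] <= 2 ->
    rank_of M [set a; c; h] <= 2 -> rank_of M [set a; b; c] <= 2.
  move=> aS hH h1 h2.
  have := @rank_sub _ M [set a; b; h] [set a; c; h] [set a; h] [set a; b; c].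
  rewrite !subUset !sub1set !inE !eqxx !orbT => /(_ isT isT isT).
  have := simple_rank2 sM (SM _ aS) (HM _ hH) (nsh _ _ aS hH).
  by move: h1 h2; clear; lia.
rewrite e3 in i123.
have d1 : h12 != h13.
  by apply: contraTneq i123 => e; rewrite -leqNgt; apply: (diff _ _ _ h12); rewrite // e.
have d2 : h12 != h23.
  apply: contraTneq i123 => e; rewrite -leqNgt (setUC [set s1]).
  by rewrite -e in c23; apply: (diff _ _ _ h12) => //; rewrite (setUC [set s2]).
have d3 : h13 != h23.
  apply: contraTneq i123 => e; rewrite -leqNgt.
  have -> : [set s1; s2; s3] = [set s3; s1; s2] by rewrite setUC setUA.
  by rewrite -e in c23; apply: (diff _ _ _ h13) => //; rewrite (setUC [set s3]).
pose C := [set s1; s2; s3]; pose H := [set h12; h13; h23]; pose B := H :|: C.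
have pair_cl a b h : a \in S -> b \in S -> a != b -> a \in C -> b \in C ->
    rank_of M [set a; b; h] <= 2 -> rank_of M (h |: C) <= rank_of M C.
  move=> aS bS nab aC bC c; rewrite (@rank_cl _ _ _ [set a; b]) //.
    by rewrite subUset !sub1set aC.
  by rewrite setUC simple_rank2 // SM.
have rB : rank_of M B <= 3.
  have clH x : x \in H -> rank_of M (x |: C) <= rank_of M C.
    rewrite !inE -!orbA => /or3P[]/eqP->.
    - by apply: (pair_cl s1 s2) => //; rewrite !inE eqxx ?orbT.
    - by apply: (pair_cl s1 s3) => //; rewrite !inE eqxx ?orbT.
    by apply: (pair_cl s2 s3) => //; rewrite !inE eqxx ?orbT.
  rewrite (rank_clU (subxx C) clH) /C setUC.
  by apply: leq_trans (rankU1 _ _ _) _; rewrite r12.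
have sH : H \subset ground M :\: S by rewrite !subUset !sub1set H12 H13.
have sBM : B \subset ground M.
  rewrite subUset (subset_trans sH (subsetDl _ _)) /=.
  by rewrite !subUset !sub1set !SM.
(* The exit points lie in the plane of the three points and in the complement of S, which does not
   span that plane. They are collinear, and this is the fourth line of the quadrilateral. *)
have rH : rank_of M H <= 2.
  have := @rank_sub _ M (ground M :\: S) B H (s1 |: (ground M :\: S)) sH (subsetUl _ _).
  have -> : s1 |: (ground M :\: S) \subset (ground M :\: S) :|: B.
    by rewrite subUset sub1set subsetUl !inE eqxx !orbT.
  by move=> /(_ isT); have := off s1 s1S; move: rB; clear; lia.
have [N [[sN avN _] gN rN]] := admissible_restrict adM sBM.
have rkN : rank N <= 3 by rewrite /rank gN rN.
have gB x : x \in B -> x \in ground N by rewrite gN.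
have tri a b c : a \in B -> b \in B -> c \in B -> a != b -> a != c -> b != c ->
    rank_of M [set a; b; c] <= 2 -> triangle N a b c.
  move=> aB bB cB nab nac nbc h; apply: simple_triangle; rewrite ?gB //.
  by rewrite rN // !subUset !sub1set aB bB.
have i3 : 2 < rk N [:: s1; s2; s3].
  rewrite /rk (_ : [set x in _] = C); last by apply/setP=> z; rewrite !inE orbA.
  by rewrite rN // subsetUr.
apply: (@no_complete_quadrilateral _ N avN rkN s1 s2 h12 h13 h23 s3) => //.
- by apply: tri; rewrite // ?(nsh s1) ?(nsh s2) // !inE eqxx ?orbT.
- rewrite -triangleR triangleC.
  by apply: tri; rewrite // ?(nsh s1) ?(nsh s3) // !inE eqxx ?orbT.
- rewrite -triangleR triangleC.
  by apply: tri; rewrite // ?(nsh s2) ?(nsh s3) // !inE eqxx ?orbT.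
by apply: tri => //; rewrite !inE eqxx ?orbT.
Qed.

Lemma extremal_structure n M : rank M = n.+2 -> admissible M ->
  #|ground M| = l * n.+1 + 1 -> parallel_closure (l + 1) M.
Proof.
elim: n M => [|n IHn] M rM adM cM; have [sM avM noU] := adM.
  apply: pc_base; apply: isomorphic_uniform2; rewrite ?rM ?cM ?muln1 //.
  by rewrite addn1.
have [|e [f [L [N [adN gN rN rNX [[eL fL nfe sL rL] cN]]]]]] := good_contraction adM.
  by rewrite rM.
have cL : #|L| <= l + 1 by apply: (line_card sM noU); rewrite ?rL.
have rN2 : rank N = n.+2 by move: rN; rewrite rM; clear; lia.
(* L has at most l + 1 points, so the contraction loses at most l of them and equality passes to
   N. *)
have cN' : #|ground N| = l * n.+1 + 1.
  have := extremal_bound rN2 adN.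
  by move: cN cL; rewrite cM mulnS; clear; lia.
(* A leaf line avoiding [f] is disjoint from L, so L stays in the complement H of S. *)
have [_ _ _ /(_ f)] := parallel_closure_facts l_ge1 (IHn N rN2 adN cN').
have fN : f \in ground N by rewrite gN setU11.
move=> /(_ fN)[S [p [[sSN pN pS cS [rSp rES]] fS]]].
pose E := ground M; have [eE fE] := (subsetP sL _ eL, subsetP sL _ fL).
have sNE : ground N \subset E by rewrite gN subUset sub1set fE subsetDl.
have eN : e \notin ground N by rewrite gN !inE eL eq_sym (negPf nfe).
have sS : S \subset E := subset_trans sSN sNE.
have eS : e \notin S by apply: contra eN; apply: (subsetP sSN).
pose H := E :\: S.
have pH : p \in H by rewrite inE pS (subsetP sNE).
have ref : rank_of M [set e; f] = 2 by rewrite simple_rank2 // eq_sym.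
have rH : rank_of M H <= n.+2.
  have : rank_of M H + rank_of M [set e; f] <=
      rank_of M (e |: (ground N :\: S)) + rank_of M L.
    apply: rank_sub; rewrite ?subUset ?sub1set ?inE ?eqxx ?fS ?fN ?orbT ?eL //.
    apply/subsetP=> z; rewrite gN !inE => /andP[-> ->].
    by case: (z \in L); rewrite ?orbT.
  by move: rES; rewrite rNX ?subsetDl // rN2 ref rL; clear; lia.
have rPi : rank_of M (e |: (p |: S)) <= 3.
  by move: rSp; rewrite rNX ?subUset ?sub1set ?pN //; clear; lia.
(* The set [e |: (p |: S)] has rank at most 3 and is already spanned by [e], [p], [s]; since [e] and
   [p] are in H, adding [s] to H gives full rank. *)
have off s : s \in S -> rank_of M H < rank_of M (s |: H).
  move=> sS'; have sN := subsetP sSN _ sS'.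
  have nps : p != s by apply: contraNneq pS => ->.
  have [simN _ _] := adN.
  have r3 : 3 <= rank_of M (e |: [set p; s]).
    have := simple_rank2 simN pN sN nps.
    by rewrite rNX ?subUset ?sub1set ?pN ?sN //; clear; lia.
  have : rank_of M E + rank_of M (e |: [set p; s]) <=
      rank_of M (s |: H) + rank_of M (e |: (p |: S)).
    have pE := subsetP sNE _ pN.
    apply: rank_sub; rewrite ?subUset ?sub1set ?inE ?eqxx ?sS' ?eS ?eE ?pS ?pE ?orbT //.
    by apply/subsetP=> z zE; rewrite !inE zE; case: (z \in S); rewrite ?orbT.
  by rewrite -/(rank M) rM; move: r3 rH rPi; clear; lia.
have offp s x y : s \in S -> x \in H -> y \in H -> x != y -> 2 < rank_of M [set s; x; y].
  move=> sS' xH yH nxy; rewrite -setUA.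
  have [xE yE] : x \in E /\ y \in E by case/setDP: xH; case/setDP: yH.
  rewrite -(simple_rank2 sM xE yE nxy) ltnNge; apply/negP=> h.
  have sxy : [set x; y] \subset H by rewrite subUset !sub1set xH.
  by have := off s sS'; rewrite (rank_cl sxy h) ltnn.
have cH : #|H| = l * n.+1 + 1.
  by rewrite cardsD (setIidPr sS) cS -/E cM mulnS; clear; lia.
have meet s s' : s \in S -> s' \in S -> s != s' ->
    exists2 h, h \in H & rank_of M [set s; s'; h] <= 2.
  move=> sS1 sS2 nss.
  have [/existsP[h /andP[hH hr]]|/existsPn none] :=
      boolP [exists h, (h \in H) && (rank_of M [set s; s'; h] <= 2)]; first by exists h.
  have far h : h \in H -> 2 < rank_of M [set s; s'; h].
    by move=> hH; have := none h; rewrite hH /= -ltnNge.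
  (* H already has the extremal number of points for rank n + 2. If the line through [s] and [s']
     missed H, contracting [s] would leave A simple with one point more and rank at most n + 2. *)
  pose A := s' |: H.
  have sE := subsetP sS _ sS1.
  have sA : A \subset E by rewrite subUset sub1set (subsetP sS) ?subsetDl.
  have nsA : s \notin A by rewrite !inE (negPf nss) sS1.
  have hA x y : x \in A -> y \in A -> x != y -> 2 < rank_of M [set s; x; y].
    rewrite /A !(in_setU1 _ s') => /predU1P[->|xH] /predU1P[->|yH]; rewrite ?eqxx // => nxy.
    - exact: far.
    - by rewrite setUAC; apply: far.
    exact: offp.
  have [N' [adN' gN' rN']] := admissible_contract adM sE sA nsA hA.
  have [simN' _ _] := adN'.
  have rle : rank N' <= n.+2.
    rewrite /rank gN' rN' //; have := rank_le_ground M (s |: A); rewrite rM; clear; lia.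
  have [m rm] : exists m, rank N' = m.+1.
    have s'N : s' \in ground N' by rewrite gN' setU11.
    have := rank_le_ground N' [set s']; rewrite simple_rank1 //.
    by case: (rank N') => // m _; exists m.
  have := extremal_bound rm adN'; rewrite gN' cardsU1 !inE sS2 cH /= => h.
  have : l * m <= l * n.+1 by rewrite leq_mul2l; move: rle; rewrite rm; clear; lia.
  by move: h; clear; lia.
have [p' p'H rp'] : exists2 p', p' \in H & rank_of M (p' |: S) <= 2.
  (* A single point is joined to any point of H by a set of at most two points; this is the case l =
     1. *)
  have [S1|S2] := leqP #|S| 1.
    exists p => //; apply: leq_trans (rank_le_card _ _) _.
    by rewrite cardsU1; case: (p \notin S); move: S1; clear; lia.
  have /card_gt1P[s1 [s2 [s1S s2S n12]]] := S2.
  exact: (@leaf_collinear M S s1 s2).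
have [M1 [ad1 g1 r1]] := admissible_restrict adM (subsetDl E S).
have p'E : p' \in E by case/setDP: p'H.
have p'S : p' \notin S by case/setDP: p'H.
have sp' : p' |: S \subset E by rewrite subUset sub1set p'E.
have [M2 [[s2 _ _] g2 r2]] := admissible_restrict adM sp'.
have rp1 : rank_of M [set p'] = 1 by apply: simple_rank1.
have cap : H :&: (p' |: S) = [set p'].
  apply/setP=> z; rewrite !inE; have [->|nz] := eqVneq z p'; first by rewrite p'S p'E.
  by case: (z \in S); rewrite ?andbF.
have cup : E = H :|: (p' |: S).
  apply/setP=> z; rewrite !inE; case zS: (z \in S); rewrite ?orbT ?orbF //=.
    exact: (subsetP sS).
  by have [->|] := eqVneq z p'; rewrite ?orbF // orbT.
have rH2 : rank_of M H = n.+2.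
  apply/eqP; rewrite eqn_leq rH /=.
  have := @rank_sub _ M H (p' |: S) [set p'] E.
  rewrite !sub1set p'H setU11 -cup subxx => /(_ isT isT isT).
  by rewrite rp1 -/(rank M) rM; move: rp'; clear; lia.
apply: (@pc_step _ _ p' M1 M2).
- by apply: IHn => //; rewrite ?g1 // /rank g1 r1.
- apply: pc_base; apply: isomorphic_uniform2 => //.
  + by rewrite /rank g2 r2.
  + by rewrite g2 cardsU1 p'S cS addnC.
  by rewrite addn1.
apply: parallel_connectionI; rewrite ?g1 ?g2 //.
by rewrite rH2 rM; move: rp'; clear; lia.
Qed.

End Extremal.

Theorem theorem5p1 (T : finType) (r l : nat) (M : matroid T)
  (r_ge1 : 1 <= r) (l_ge1 : 1 <= l)
  (M_simple : simple M) (M_rank : rank M = r)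
  (M_noU : ~ has_minor M (uniform 2 (l + 2)))
  (M_no1 : ~ has_minor M M_1) (M_no2 : ~ has_minor M M_2)
  (M_no3 : ~ has_minor M M_3) (M_no4 : ~ has_minor M M_4)
  (M_no5 : ~ has_minor M M_5) (M_no6 : ~ has_minor M M_6)
  (M_no7 : ~ has_minor M M_7) (M_no8 : ~ has_minor M M_8)
  (M_noQ : ~ has_minor M Q) :
  #|ground M| <= l * (r - 1) + 1 /\
  (2 <= r -> (#|ground M| = l * (r - 1) + 1 <-> parallel_closure (l + 1) M)).
Proof.
have adM : admissible l M by split=> //; split.
case: r r_ge1 M_rank => // n _ rM; rewrite subn1 /=.
split; first exact: extremal_bound.
case: n rM => // n rM _; split=> [cM|pcM]; first exact: (extremal_structure l_ge1 rM adM cM).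
by have [_ _ -> _] := parallel_closure_facts l_ge1 pcM; rewrite rM subn1.
Qed.
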